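(* Let $H$ be a complex Hilbert space, let $T$ be a closed (possibly unbounded) linear operator in $H$ with domain $D(T)\subset H$, and let $N$ be a (possibly unbounded) normal operator in $H$ with domain $D(N)$. If $D(N)\subset D(T)$ and $TN\subset NT$, then $TN^*\subset N^*T$.
   Context: A densely defined closed operator $N$ is normal if $NN^*=N^*N$ (including equality of domains). For linear operators $S,R$, the product $SR$ is defined on $D(SR)=\{x\in D(R): Rx\in D(S)\}$ by $(SR)x=S(Rx)$. For operators $S_1,S_2$, $S_1\subset S_2$ means $D(S_1)\subset D(S_2)$ and $S_2x=S_1x$ for all $x\in D(S_1)$. *)

(* Defs.v *)
From mathcomp Require Import all_boot all_order all_algebra.
From mathcomp Require Import reals complex.
Import GRing.Theory Num.Theory.
Set Implicit Arguments. Unset Strict Implicit. Unset Printing Implicit Defensive.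
Local Open Scope ring_scope.
Local Open Scope complex_scope.

Section Hilbert.
Variables (R : realType) (H : lmodType R[i]).

Record is_inner_product (ip : H -> H -> R[i]) : Prop := {
  ip_linl : forall (a : R[i]) (x y z : H), ip (a *: x + y) z = a * ip x z + ip y z;
  ip_conj : forall x y : H, ip x y = (ip y x)^*;
  ip_ge0  : forall x : H, 0 <= ip x x;
  ip_eq0  : forall x : H, ip x x = 0 -> x = 0 }.

Variable ip : H -> H -> R[i].

Definition cvg_to (u : nat -> H) (x : H) : Prop :=
  forall e : R[i], 0 < e -> exists N : nat, forall n : nat, (N <= n)%N ->
    ip (u n - x) (u n - x) < e.

Definition cauchy_seq (u : nat -> H) : Prop :=
  forall e : R[i], 0 < e -> exists N : nat, forall n m : nat,
    (N <= n)%N -> (N <= m)%N -> ip (u n - u m) (u n - u m) < e.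

Definition is_hilbert : Prop :=
  is_inner_product ip /\ forall u, cauchy_seq u -> exists x, cvg_to u x.

(* A (possibly unbounded) operator: a domain and an action (only the values
   on the domain are meaningful). *)
Record op := Op { dom : H -> Prop; app : H -> H }.

Definition linear_op (T : op) : Prop :=
  [/\ dom T 0,
      forall x y, dom T x -> dom T y -> dom T (x + y),
      forall (a : R[i]) x, dom T x -> dom T (a *: x),
      forall x y, dom T x -> dom T y -> app T (x + y) = app T x + app T y
    & forall (a : R[i]) x, dom T x -> app T (a *: x) = a *: app T x].

Definition dense (D : H -> Prop) : Prop :=
  forall x, exists u : nat -> H, (forall n, D (u n)) /\ cvg_to u x.

Definition closed_op (T : op) : Prop :=
  forall (u : nat -> H) (x y : H), (forall n, dom T (u n)) ->
    cvg_to u x -> cvg_to (fun n => app T (u n)) y -> dom T x /\ app T x = y.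

Definition is_adjoint (T S : op) : Prop :=
  (forall y, dom S y <-> exists z, forall x, dom T x -> ip (app T x) y = ip x z) /\
  (forall x y, dom T x -> dom S y -> ip (app T x) y = ip x (app S y)).

Definition op_comp (S T : op) : op :=
  Op (fun x => dom T x /\ dom S (app T x)) (fun x => app S (app T x)).

Definition op_sub (S1 S2 : op) : Prop :=
  (forall x, dom S1 x -> dom S2 x) /\ (forall x, dom S1 x -> app S2 x = app S1 x).

Definition op_eq (S1 S2 : op) : Prop :=
  (forall x, dom S1 x <-> dom S2 x) /\ (forall x, dom S1 x -> app S1 x = app S2 x).

Definition normal_op (N Nstar : op) : Prop :=
  [/\ linear_op N, dense (dom N), closed_op N, is_adjoint N Nstar
    & op_eq (op_comp N Nstar) (op_comp Nstar N)].

End Hilbert.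

(* Main.v *)
Require Import Defs.
From mathcomp Require Import all_boot all_order all_algebra.
From mathcomp Require Import classical_sets boolp reals complex.
From mathcomp Require Import ring lra cyclic separable cyclotomic.
Import Order.TTheory GRing.Theory Num.Theory.
Set Implicit Arguments.
Unset Strict Implicit.
Unset Printing Implicit Defensive.
Local Open Scope ring_scope.
Local Open Scope complex_scope.

(* Let B = (1 + N* N)^-1, which commutes with N and N*.  By the closed graph
   theorem T B and T N* B are bounded.  For e > 0, the square root of (B - e)^2
   yields a closed subspace W_e on which B >= e: it is invariant under N and N*,
   both bounded there, and a vector orthogonal to all the W_e vanishes.

   On W_e, Fuglede's theorem is proved without exponentials.  Since N is normal
   and T commutes with it,
     |(1 + mu N* )^n T y| = |T (1 + conj(mu) N)^n y| <= c |(1 + mu N* )^n y|.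
   Taking for y the n-th power of a truncated Neumann series of (1 + mu N* )^-1
   applied to x, the right-hand side is at most 2 c |x| on a fixed circle
   |mu| = rho.  The left-hand side is the norm of a polynomial in mu whose linear
   coefficient is n (N* T - T N* ) x; Cauchy's estimate bounds rho n times the
   norm of (N* T - T N* ) x by 2 c |x| for all n.

   By density N* T B = T N* B and B T B = T B^2 everywhere.  Every y in D(T) is
   B y + N z with z = N* B y in D(N), so T N < N T gives B T < T B, and the
   factor B can be removed from the identity N* B T x = B T N* x. *)

(** * Hermitian forms, norm and limits *)

Section RealPart.
Variables (R : realType) (H : lmodType R[i]) (b : H -> H -> R[i]).

(** Only semi-definite: the record has to cover the forms [ip (act p x) y] of positive operators, so
    that Cauchy-Schwarz can be applied to them. *)
Record is_form : Prop := {
  form_linl : forall (a : R[i]) (x y z : H), b (a *: x + y) z = a * b x z + b y z;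
  form_conj : forall x y : H, b x y = (b y x)^*;
  form_ge0  : forall x : H, 0 <= b x x }.

(** Estimates are carried out over the ordered field [R] with this symmetric real bilinear form;
    [formE] recovers the complex form from it. *)
Definition reip (x y : H) : R := complex.Re (b x y).
Local Notation rip := reip.

Hypothesis hb : is_form.

Lemma ripC x y : rip x y = rip y x.
Proof. by rewrite /reip (form_conj hb); case: (b y x). Qed.

Lemma ripDl x y z : rip (x + y) z = rip x z + rip y z.
Proof. by rewrite /reip -[x]scale1r (form_linl hb) mul1r scale1r raddfD. Qed.

Lemma ripDr x y z : rip z (x + y) = rip z x + rip z y.
Proof. by rewrite ripC ripDl !(ripC z). Qed.

Lemma rip0l z : rip 0 z = 0.
Proof. by have := ripDl 0 0 z; rewrite addr0; lra. Qed.

Lemma formZl a x z : b (a *: x) z = a * b x z.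
Proof.
have b0 : b 0 z = 0.
  by have := form_linl hb 1 0 0 z; rewrite scaler0 add0r mul1r => /eqP; rewrite addrC -subr_eq subrr => /eqP.
by rewrite -[a *: x]addr0 (form_linl hb) b0 addr0.
Qed.

Lemma formZr a x z : b z (a *: x) = a^* * b z x.
Proof. by rewrite (form_conj hb) formZl rmorphM (form_conj hb z). Qed.

Lemma ripZl (r : R) x z : rip (r%:C *: x) z = r * rip x z.
Proof. by rewrite /reip formZl; case: (b x z) => p q /=; ring. Qed.

Lemma ripZr (r : R) x z : rip z (r%:C *: x) = r * rip z x.
Proof. by rewrite ripC ripZl ripC. Qed.

Lemma ripNl x z : rip (- x) z = - rip x z.
Proof. by rewrite -scaleN1r -(rmorphN1 (real_complex R)) ripZl mulN1r. Qed.

Lemma ripNr x z : rip z (- x) = - rip z x.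
Proof. by rewrite ripC ripNl ripC. Qed.

Lemma ripBl x y z : rip (x - y) z = rip x z - rip y z.
Proof. by rewrite ripDl ripNl. Qed.

Lemma ripBr x y z : rip z (x - y) = rip z x - rip z y.
Proof. by rewrite ripDr ripNr. Qed.

Definition ripE := (ripDl, ripDr, ripBl, ripBr, ripNl, ripNr, ripZl, ripZr).

Lemma rip_ge0 x : 0 <= rip x x.
Proof. by have := form_ge0 hb x; rewrite lecE => /andP[]. Qed.

Lemma formxx x : b x x = (rip x x)%:C.
Proof. by rewrite /reip; have /ger0_Im := form_ge0 hb x; case: (b x x) => p q /= ->. Qed.

(** As [b x ('i *: y)] equals [- 'i * b x y], its real part is the imaginary part of [b x y]. *)
Lemma formE x y : b x y = Complex (rip x y) (rip x ('i *: y)).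
Proof. by rewrite /reip formZr; case: (b x y) => p q /=; congr Complex; ring. Qed.

Lemma form_rip_eq x y x' y' : (forall a, rip x (a *: y) = rip x' (a *: y')) -> b x y = b x' y'.
Proof. by move=> h; rewrite !formE -(h 'i) -[y]scale1r -[y']scale1r (h 1). Qed.

Lemma ripiC x y : rip x ('i *: y) = - rip ('i *: x) y.
Proof. by rewrite /reip formZl formZr; case: (b x y) => p q /=; ring. Qed.

Lemma rip_scale a x : rip (a *: x) (a *: x) = (complex.Re `|a|) ^+ 2 * rip x x.
Proof.
rewrite {1}/reip formZl formZr mulrA -sqr_normc formxx.
by rewrite -{1}(RRe_real (normr_real a)) expr2 /= mul0r !subr0; ring.
Qed.

Lemma CauchySchwarz_sqr x y : rip x y ^+ 2 <= rip x x * rip y y.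
Proof.
have key t : 0 <= rip x x - 2 * t * rip x y + t ^+ 2 * rip y y.
  have := rip_ge0 (x - t%:C *: y); rewrite !ripE (ripC y x); lra.
have := rip_ge0 y; rewrite le_eqVlt => /orP[/eqP y0|y0].
  rewrite -y0 mulr0; case: (eqVneq (rip x y) 0) => [->|n0]; first by rewrite expr0n.
  (* When [rip y y] vanishes, the quadratic in [key] is affine in [t], and this [t] gives it the
     value -1. *)
  have := key ((rip x x + 1) / (2 * rip x y)); rewrite -y0.
  suff -> : 2 * ((rip x x + 1) / (2 * rip x y)) * rip x y = rip x x + 1 by lra.
  by field.
have := key (rip x y / rip y y).
have -> : rip x x - 2 * (rip x y / rip y y) * rip x y + (rip x y / rip y y) ^+ 2 * rip y y
   = rip x x - rip x y ^+ 2 / rip y y by field; rewrite gt_eqF.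
by rewrite subr_ge0 ler_pdivrMr.
Qed.

End RealPart.

Section Norm.
Variables (R : realType) (H : lmodType R[i]) (ip : H -> H -> R[i]).

Definition hnorm (x : H) : R := Num.sqrt (reip ip x x).
Local Notation nrm := hnorm.

Definition hlim (u : nat -> H) (x : H) :=
  forall e : R, 0 < e -> exists N, forall n, (N <= n)%N -> nrm (u n - x) < e.
Local Notation tends := hlim.

Definition subspace (V : H -> Prop) :=
  [/\ V 0, forall x y, V x -> V y -> V (x + y) & forall (a : R[i]) x, V x -> V (a *: x)].

Lemma subspaceN V x : subspace V -> V x -> V (- x).
Proof. by case=> _ _ h /(h (-1)); rewrite scaleN1r. Qed.

Lemma subspaceB V x y : subspace V -> V x -> V y -> V (x - y).
Proof. by move=> sV ? ?; have [_ + _] := sV; apply=> //; exact: subspaceN. Qed.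

Lemma subspace_sum V d (h : nat -> H) : subspace V -> (forall k, V (h k)) -> V (\sum_(k < d) h k).
Proof. by case=> V0 VD _ hV; apply: (big_ind V). Qed.

Hypothesis hI : is_inner_product ip.

Lemma ip_form : is_form ip. Proof. by case: hI. Qed.
Local Notation rip := (reip ip).
Let hF := ip_form.

Lemma nrm_ge0 x : 0 <= nrm x. Proof. exact: sqrtr_ge0. Qed.

Lemma nrm_sqr x : nrm x ^+ 2 = rip x x.
Proof. by rewrite sqr_sqrtr ?rip_ge0. Qed.

Lemma nrm0 : nrm 0 = 0. Proof. by rewrite /hnorm rip0l ?sqrtr0. Qed.

Lemma nrm_le x y : (nrm x <= nrm y) = (rip x x <= rip y y).
Proof. by rewrite /hnorm ler_sqrt ?rip_ge0. Qed.

Lemma nrm_le_sqr x r : 0 <= r -> rip x x <= r ^+ 2 -> nrm x <= r.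
Proof. by move=> r0; rewrite -nrm_sqr ler_sqr ?nnegrE ?nrm_ge0. Qed.

Lemma rip_eq0 x : rip x x = 0 -> x = 0.
Proof. by move=> h; apply: (ip_eq0 hI); rewrite formxx // h. Qed.

Lemma nrm_eq0 x : nrm x <= 0 -> x = 0.
Proof.
move=> h; apply: rip_eq0; rewrite -nrm_sqr.
have -> : nrm x = 0 by apply/eqP; rewrite eq_le h nrm_ge0.
by rewrite expr0n.
Qed.

Lemma nrmZ a x : nrm (a *: x) = complex.Re `|a| * nrm x.
Proof.
rewrite /hnorm rip_scale // sqrtrM ?sqr_ge0 // sqrtr_sqr ger0_norm //.
by have := normr_ge0 a; rewrite lecE => /andP[].
Qed.

Lemma nrmZr (r : R) x : nrm (r%:C *: x) = `|r| * nrm x.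
Proof. by rewrite nrmZ normc_def /= expr0n addr0 sqrtr_sqr. Qed.

Lemma nrmN x : nrm (- x) = nrm x.
Proof. by rewrite -scaleN1r nrmZ normrN1 mul1r. Qed.

Lemma nrmBC x y : nrm (x - y) = nrm (y - x).
Proof. by rewrite -nrmN opprB. Qed.

Lemma rip_le x y : rip x y <= nrm x * nrm y.
Proof.
apply: le_trans (ler_norm _) _; rewrite -sqrtr_sqr /hnorm -sqrtrM ?rip_ge0 //.
by rewrite ler_wsqrtr // CauchySchwarz_sqr.
Qed.

Lemma nrmD x y : nrm (x + y) <= nrm x + nrm y.
Proof.
apply: nrm_le_sqr; first by rewrite addr_ge0 ?nrm_ge0.
have := rip_le x y; rewrite !ripE // (ripC hF y x) sqrrD !nrm_sqr; lra.
Qed.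

Lemma nrmB x y : nrm (x - y) <= nrm x + nrm y.
Proof. by rewrite -(nrmN y) nrmD. Qed.

Lemma nrm_dist x y z : nrm (x - z) <= nrm (x - y) + nrm (y - z).
Proof. by apply: le_trans (nrmD _ _); rewrite addrA subrK. Qed.

Lemma nrm_sum d (h : nat -> H) : nrm (\sum_(k < d) h k) <= \sum_(k < d) nrm (h k).
Proof.
elim: d => [|d IH]; first by rewrite !big_ord0 nrm0.
by rewrite !big_ord_recr /=; apply: le_trans (nrmD _ _) _; rewrite lerD2r.
Qed.

Lemma parallelogram x y :
  rip (x + y) (x + y) + rip (x - y) (x - y) = 2 * rip x x + 2 * rip y y.
Proof. by rewrite !ripE // (ripC hF y x); ring. Qed.

(** A positive element of [R[i]] is a positive real, and [cvg_to] bounds the squared norm, so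
    tolerances correspond under squaring and square roots. *)
Lemma cvg_tends u x : cvg_to ip u x <-> tends u x.
Proof.
split=> h e e0.
  have [|N hN] := h (e ^+ 2)%:C; first by rewrite (ltcR 0) exprn_gt0.
  exists N => n /hN; rewrite formxx // ltcR -nrm_sqr ltr_sqr ?nnegrE ?nrm_ge0 //.
  exact: ltW.
have [er ei] : 0 < complex.Re e /\ complex.Im e = 0.
  by move: e0; rewrite ltcE /= => /andP[/eqP -> ->].
have [|N hN] := h (Num.sqrt (complex.Re e)); first by rewrite sqrtr_gt0.
exists N => n /hN; rewrite /hnorm ltr_sqrt // formxx // => hn.
by rewrite ltcE /= ei eqxx.
Qed.

Lemma tends_cst x : tends (fun=> x) x.
Proof. by move=> e e0; exists 0%N => n _; rewrite subrr nrm0. Qed.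

Lemma tends_dom (u v : nat -> H) x y c :
  (forall n, nrm (u n - x) <= c * nrm (v n - y)) -> tends v y -> tends u x.
Proof.
move=> h hv e e0.
(* The sign of [c] is unknown; this is a positive upper bound for it. *)
have c0 : 0 < `|c| + 1 by rewrite ltr_wpDl.
have [|N hN] := hv (e / (`|c| + 1)); first by rewrite divr_gt0.
exists N => n /hN; rewrite ltr_pdivlMr // => hn.
apply: le_lt_trans (h n) (le_lt_trans _ hn).
rewrite mulrC ler_wpM2l ?nrm_ge0 //; have := ler_norm c; lra.
Qed.

Lemma tends_bounded (L : H -> H) c u x :
  (forall x y, L (x - y) = L x - L y) -> (forall x, nrm (L x) <= c * nrm x) ->
  tends u x -> tends (fun n => L (u n)) (L x).
Proof. by move=> hB hL; apply: tends_dom => n; rewrite -hB; exact: hL. Qed.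

Lemma tendsD u v x y : tends u x -> tends v y -> tends (fun n => u n + v n) (x + y).
Proof.
move=> hu hv e e0.
have e2 : 0 < e / 2 by lra.
have [N hN] := hu _ e2; have [M hM] := hv _ e2.
exists (maxn N M) => n; rewrite geq_max => /andP[/hN h1 /hM h2].
rewrite opprD addrACA; apply: le_lt_trans (nrmD _ _) _; lra.
Qed.

Lemma tendsZ a u x : tends u x -> tends (fun n => a *: u n) (a *: x).
Proof. by apply: tends_dom => n; rewrite -scalerBr nrmZ. Qed.

Lemma nrm_lt_eq0 x : (forall e, 0 < e -> nrm x < e) -> x = 0.
Proof. by move=> h; apply: nrm_eq0; rewrite leNgt; apply/negP => /h; rewrite ltxx. Qed.

Lemma tends_unique u x y : tends u x -> tends u y -> x = y.
Proof.
move=> hx hy; apply/eqP; rewrite -subr_eq0; apply/eqP; apply: nrm_lt_eq0 => e e0.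
have e2 : 0 < e / 2 by lra.
have [N hN] := hx _ e2; have [M hM] := hy _ e2.
have {hN} := hN (maxn N M) (leq_maxl _ _); have {hM} := hM (maxn N M) (leq_maxr _ _).
have := nrm_dist x (u (maxn N M)) y; rewrite (nrmBC x (u _)); lra.
Qed.

Lemma nrm_lim_le u x c : tends u x -> (forall n, nrm (u n) <= c) -> nrm x <= c.
Proof.
move=> hu hc; rewrite leNgt; apply/negP => cx.
have [|N /(_ N (leqnn _))] := hu (nrm x - c); first lra.
have := nrmD (x - u N) (u N); rewrite subrK nrmBC; have := hc N; lra.
Qed.

(** Passes adjointness relations to the limit: by Cauchy-Schwarz the error is at most |u n - x| |a|
    + |c| |v n - y|. *)
Lemma rip_lim u x v y a c : tends u x -> tends v y ->
  (forall n, rip (u n) a = rip c (v n)) -> rip x a = rip c y.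
Proof.
move=> hu hv h; apply/eqP; rewrite -subr_eq0 -normr_le0 leNgt; apply/negP => d0.
set d := `|_| in d0.
have p0 : 0 < nrm a + nrm c + 1 by have := nrm_ge0 a; have := nrm_ge0 c; lra.
have e0 : 0 < d / (nrm a + nrm c + 1) by exact: divr_gt0.
have [N hN] := hu _ e0; have [M hM] := hv _ e0.
have {hN} := hN (maxn N M) (leq_maxl _ _); have {hM} := hM (maxn N M) (leq_maxr _ _).
set n := maxn N M; rewrite !ltr_pdivlMr // => h1 h2.
have hd : d <= nrm (u n - x) * nrm a + nrm c * nrm (v n - y).
  rewrite /d ler_norml; apply/andP; split.
    have := rip_le (u n - x) a; have := rip_le c (y - v n).
    rewrite (nrmBC y) !ripE // (h n); lra.
  have := rip_le (x - u n) a; have := rip_le c (v n - y).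
  rewrite (nrmBC x) !ripE // (h n); lra.
have := nrm_ge0 (u n - x); have := nrm_ge0 (v n - y).
have := nrm_ge0 a; have := nrm_ge0 c; nra.
Qed.

Lemma orth_lim u x a : tends u x -> (forall n, rip (u n) a = 0) -> rip x a = 0.
Proof.
move=> hu h; have -> : 0 = rip 0 0 :> R by rewrite rip0l.
by apply: (rip_lim hu (tends_cst 0)) => n; rewrite h rip0l.
Qed.

End Norm.

Lemma monotone_bounded_cauchy (R : realType) (a : nat -> R) (m : R) :
  (forall n, a n <= a n.+1) -> (forall n, a n <= m) ->
  forall e : R, 0 < e -> exists N, forall n, (N <= n)%N -> a N <= a n < a N + e.
Proof.
move=> ai am e e0; pose E := [set x | exists n, x = a n]%classic.
have hE : has_sup E by split; [exists (a 0%N), 0%N | exists m => _ [n ->]].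
have [_ [N ->] hN] := sup_adherent e0 hE; exists N => n Nn; apply/andP; split.
  by elim: n Nn => [|n IH]; rewrite leq_eqVlt => /orP[/eqP <-|] // /IH/le_trans; apply.
have En : E (a n) by exists n.
by have := sup_upper_bound hE En; lra.
Qed.

Lemma inv_succ_lt (R : realType) (e : R) : 0 < e -> exists N, forall n, (N <= n)%N -> n.+1%:R^-1 < e.
Proof.
move=> e0; have [N hN] : exists N : nat, e^-1 < N%:R.
  by exists (Num.bound e^-1); apply: archi_boundP; rewrite invr_ge0 ltW.
exists N => n Nn; rewrite invf_plt ?posrE ?ltr0Sn //; apply: lt_le_trans hN _.
by rewrite ler_nat; apply: leqW.
Qed.

(** * Orthogonal projection and the closed graph theorem *)

Lemma inv_exp2_le (R : realType) n : (2^-1 : R) ^+ n <= n.+1%:R^-1.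
Proof.
rewrite exprVn lef_pV2 ?posrE ?exprn_gt0 ?ltr0Sn // -natrX ler_nat.
exact: ltn_expl.
Qed.

Section Hilbert.
Variables (R : realType) (H : lmodType R[i]) (ip : H -> H -> R[i]).
Hypothesis hH : is_hilbert ip.
Local Notation rip := (reip ip).
Local Notation nrm := (hnorm ip).
Local Notation tends := (hlim ip).
Let hI : is_inner_product ip. Proof. by case: hH. Qed.
Let hF : is_form ip. Proof. exact: ip_form. Qed.

(** By the triangle inequality it is enough to compare every late term with the single term
    [u N]. *)
Lemma complete (u : nat -> H) :
  (forall e, 0 < e -> exists N, forall n, (N <= n)%N -> nrm (u n - u N) < e) ->
  exists x, tends u x.
Proof.
move=> h; case: hH => _ /(_ u) []; last by move=> x /(cvg_tends hI); exists x.
move=> e e0; have [er ei] : 0 < complex.Re e /\ complex.Im e = 0.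
  by move: e0; rewrite ltcE /= => /andP[/eqP -> ->].
have s0 : 0 < Num.sqrt (complex.Re e) / 2 by rewrite divr_gt0 ?sqrtr_gt0.
have [N hN] := h _ s0; exists N => n m /hN hn /hN hm.
have hnm : nrm (u n - u m) < Num.sqrt (complex.Re e).
  by have := nrm_dist hI (u n) (u N) (u m); rewrite (nrmBC hI (u N)); lra.
move: hnm; rewrite /hnorm ltr_sqrt // formxx // => hnm.
by rewrite ltcE /= ei eqxx.
Qed.

Lemma orth_min z w : (forall t : R, nrm z <= nrm (z - t%:C *: w)) -> rip z w = 0.
Proof.
move=> h; have c0 : 0 <= rip w w by exact: rip_ge0.
(* The optimal [t] would be [rip z w / rip w w]; the added 1 keeps the quotient meaningful for
   [w = 0] and still forces [t = 0]. *)
have := h (rip z w / (rip w w + 1)); rewrite nrm_le // !ripE // (ripC hF w z).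
set r := rip z w; set c := rip w w in c0 *; set t := r / (c + 1).
have rE : r = t * (c + 1) by rewrite /t divfK // gt_eqF // ltr_wpDl.
move=> hh; suff t0 : t = 0 by rewrite rE t0 mul0r.
rewrite rE in hh; move: hh; clearbody t => hh.
apply/eqP; rewrite -sqrf_eq0 -[_ == 0]negbK; apply/negP => /negbTE tn.
have t0 : 0 < t ^+ 2 by rewrite lt_neqAle eq_sym tn sqr_ge0.
have : 0 <= t * c; nra.
Qed.

(** The foot [p] lies in the closure of [V], so it is given as a limit of points of [V]. A
    minimizing sequence for the distance is Cauchy by the parallelogram law. *)
Lemma projection (V : H -> Prop) v : subspace V ->
  exists u p, [/\ forall n, V (u n), tends u p & forall w, V w -> rip (v - p) w = 0].
Proof.
move=> sV; have [V0 VD VZ] := sV.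
pose E : set R := [set x | exists2 w, V w & x = - nrm (v - w)]%classic.
have hE : has_sup E.
  by split; [exists (- nrm (v - 0)), 0 | exists 0 => _ [w _ ->]; rewrite oppr_le0 nrm_ge0].
pose d : R := - sup E.
have dle w : V w -> d <= nrm (v - w).
  move=> Vw; have Ew : E (- nrm (v - w)) by exists w.
  by have := sup_upper_bound hE Ew; rewrite /d; lra.
have d0 : 0 <= d.
  have [_ [w Vw ->] _] := sup_adherent ltr01 hE.
  rewrite /d oppr_ge0; apply: ge_sup; first by case: hE.
  by move=> _ [x _ ->]; rewrite oppr_le0 nrm_ge0.
have near n : exists x, V x /\ nrm (v - x) < d + n.+1%:R^-1.
  have [|_ [w Vw ->] hw] := sup_adherent _ hE (eps := n.+1%:R^-1); first by rewrite invr_gt0 ltr0Sn.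
  exists w; split=> //; rewrite /d; move: hw; set y := _^-1; lra.
have [u hu] := choice near.
have Vu n : V (u n) by case: (hu n).
have [p up] : exists p, tends u p.
  apply: complete => e e0.
  have D0 : 0 < 8 * d + 4 + e ^+ 2 by have := sqr_ge0 e; lra.
  (* The parallelogram law gives |u n - u N|^2 <= 4 (d + y)^2 - 4 d^2 = 8 d y + 4 y^2 with [y] the
     inverse of [N.+1]. The summand [e ^+ 2] in the denominator forces y < 1, so this is at most (8
     d + 4) y < e^2. *)
  have [|N hN] := @inv_succ_lt R (e ^+ 2 / (8 * d + 4 + e ^+ 2)); first by rewrite divr_gt0 ?exprn_gt0.
  exists N => n Nn; rewrite -ltr_sqr ?nnegrE ?nrm_ge0 ?(ltW e0) // nrm_sqr //.
  have := hN N (leqnn _); set y := N.+1%:R^-1; rewrite ltr_pdivlMr // => hy.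
  have y0 : 0 <= y by rewrite invr_ge0 ler0n.
  have h1 : nrm (v - u N) < d + y by case: (hu N).
  have h2 : nrm (v - u n) < d + y.
    case: (hu n) => _ /lt_le_trans; apply; rewrite lerD2l lef_pV2 ?posrE ?ltr0Sn //.
    by rewrite ler_nat.
  have h3 : 2 * d <= nrm (v - u n + (v - u N)).
    have -> : v - u n + (v - u N) = (2%:R : R)%:C *: (v - (2^-1 : R)%:C *: (u n + u N)).
      rewrite scalerBr scalerA -rmorphM mulfV ?pnatr_eq0 // scale1r.
      by rewrite addrACA -opprD -mulr2n -scaler_nat rmorph_nat.
    rewrite nrmZr // ger0_norm // ler_pM2l ?ltr0n //; apply: dle.
    by apply: (VZ); apply: VD.
  have := parallelogram hI (v - u n) (v - u N).
  have -> : v - u n - (v - u N) = - (u n - u N) by rewrite opprB addrC opprB addrA subrK.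
  rewrite !ripNl // !ripNr // opprK -!(nrm_sqr hI).
  have := nrm_ge0 ip (v - u N); have := nrm_ge0 ip (v - u n).
  move: h1 h2 h3; move: (nrm _) (nrm (v - u N)) (nrm (v - u n)) (nrm _) => A1 A2 A3 A4.
  nra.
exists u, p; split=> // w Vw; apply: orth_min => t.
(* The distance [d] is attained at [p], while [p + t w] is a limit of points of [V] and therefore
   lies no closer to [v]. *)
apply: (@le_trans _ _ d).
  rewrite leNgt; apply/negP => dp.
  have e0 : 0 < (nrm (v - p) - d) / 2 by lra.
  have [N hN] := up _ e0; have [M hM] := inv_succ_lt e0.
  have {hN} := hN (maxn N M) (leq_maxl _ _); have {hM} := hM (maxn N M) (leq_maxr _ _).
  have [_] := hu (maxn N M); have := nrm_dist hI v (u (maxn N M)) p.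
  by set y := _.+1%:R^-1; lra.
rewrite leNgt; apply/negP => dp; have {}dp : 0 < d - nrm (v - p - t%:C *: w) by lra.
have [N /(_ N (leqnn _)) hN] := up _ dp.
have := nrmD hI (v - p - t%:C *: w) (p - u N); rewrite nrmBC // in hN *.
have -> : v - p - t%:C *: w + (p - u N) = v - (u N + t%:C *: w).
  by rewrite addrAC addrA subrK opprD addrA.
by have := dle (u N + t%:C *: w) (VD _ _ (Vu N) (VZ _ _ Vw)); lra.
Qed.

(** If no [F n] were dense in a ball, there would be nested closed balls [s n] with radii at most
    2^-n, the ball of index [n.+1] missing [F n]. The limit of the centres lies in all of them,
    hence in no [F n]. *)
Lemma baire (F : nat -> H -> Prop) : (forall x, exists n, F n x) ->
  exists n x0 (d : R), 0 < d /\
    forall x, nrm (x - x0) < d -> forall e, 0 < e -> exists2 y, F n y & nrm (x - y) < e.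
Proof.
move=> cov; apply: contrapT => hno.
have step (a : nat * (H * R)) : exists b : H * R, 0 < a.2.2 ->
    [/\ 0 < b.2, b.2 <= a.2.2 / 2, nrm (b.1 - a.2.1) + b.2 <= a.2.2
      & forall y, nrm (y - b.1) <= b.2 -> ~ F a.1 y].
  (* For a radius that is not positive the requirement is void, and (0, 0) is a dummy value that
     makes the choice function total. *)
  case: a => n [c r] /=; case: (pselect (0 < r)) => [r0|]; last by exists (0, 0).
  apply: contrapT => hb; apply: hno; exists n, c, (r / 2); split; first lra.
  move=> x xc e e0; apply: contrapT => hy; apply: hb.
  exists (x, Num.min (r / 2) (e / 2)) => _ /=; split.
  - by rewrite lt_min; apply/andP; split; lra.
  - by rewrite ge_min lexx.
  - by have : Num.min (r / 2) (e / 2) <= r / 2 by [rewrite ge_min lexx]; lra.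
  - move=> y yx Fy; apply: hy; exists y => //; rewrite nrmBC //.
    apply: le_lt_trans yx _; have : Num.min (r / 2) (e / 2) <= e / 2; last lra.
    by rewrite ge_min lexx orbT.
have [f hf] := choice step.
pose s := fix s n : H * R := if n is n'.+1 then f (n', s n') else (0, 1).
have s0 n : 0 < (s n).2.
  by elim: n => [|n IH]; [exact: ltr01 | case: (hf (n, s n) IH)].
have s2 n : (s n).2 <= n.+1%:R^-1.
  apply: le_trans (inv_exp2_le R n); elim: n => [|n IH]; first by rewrite expr0.
  by case: (hf (n, s n) (s0 n)) => _ + _ _; rewrite exprS /=; lra.
have sd n k : nrm ((s (n + k)%N).1 - (s n).1) + (s (n + k)%N).2 <= (s n).2.
  elim: k => [|k IH]; first by rewrite addn0 subrr nrm0 // add0r.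
  rewrite addnS; case: (hf ((n + k)%N, s (n + k)%N) (s0 _)) => _ _ /= h _.
  by have := nrm_dist hI (s (n + k).+1).1 (s (n + k)%N).1 (s n).1; rewrite /= in IH h *; lra.
have [x hx] : exists x, tends (fun n => (s n).1) x.
  apply: complete => e /inv_succ_lt[N /(_ N (leqnn _)) hN]; exists N => n /subnKC <-.
  by apply: le_lt_trans hN; apply: le_trans (s2 N); have := sd N (n - N)%N; have := s0 (N + (n - N))%N; lra.
have [n Fn] := cov x; case: (hf (n, s n) (s0 n)) => _ _ _ /(_ x) /=; apply=> //.
rewrite leNgt; apply/negP => hlt.
have {}hlt : 0 < nrm (x - (s n.+1).1) - (s n.+1).2 by rewrite /=; lra.
have [N /(_ (n.+1 + N)%N (leq_addl _ _))] := hx _ hlt.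
have := sd n.+1 N; have := s0 (n.+1 + N)%N.
have := nrm_dist hI x (s (n.+1 + N)%N).1 (s n.+1).1; rewrite (nrmBC hI x (s (_ + _)%N).1).
set a := nrm _; set b := nrm _; set c := nrm _; lra.
Qed.

Definition islin (L : H -> H) :=
  (forall x y, L (x + y) = L x + L y) /\ (forall a x, L (a *: x) = a *: L x).

Lemma islinN L x : islin L -> L (- x) = - L x.
Proof. by case=> _ LZ; rewrite -scaleN1r LZ scaleN1r. Qed.

Lemma islinB L x y : islin L -> L (x - y) = L x - L y.
Proof. by move=> hL; rewrite (proj1 hL) islinN. Qed.

Lemma islin0 L : islin L -> L 0 = 0.
Proof. by move=> hL; have := islinB 0 0 hL; rewrite !subrr. Qed.

Definition bounded_by (c : R) (L : H -> H) := forall x, nrm (L x) <= c * nrm x.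

Lemma lin_tends L c u x : islin L -> bounded_by c L -> tends u x -> tends (fun n => L (u n)) (L x).
Proof. by move=> hL; apply: tends_bounded => // y z; apply: islinB. Qed.

(* By Baire, every x is within |x|/2 of some y with |L y| <= C |x|; iterating and
   summing the geometric series, the closed graph gives |L x| <= 2 C |x|. *)
Lemma closed_graph L : islin L ->
  (forall u x y, tends u x -> tends (fun n => L (u n)) y -> L x = y) ->
  exists c, bounded_by c L.
Proof.
move=> hL clL.
have [|n [x0 [d [d0 hd]]]] := @baire (fun n x => nrm (L x) <= n%:R).
  by move=> x; exists (Num.bound (nrm (L x))); apply/ltW/archi_boundP/nrm_ge0.
pose C : R := 4 * n%:R / d.
have C0 : 0 <= C by rewrite divr_ge0 ?mulr_ge0 ?ler0n ?(ltW d0).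
have half x : exists y, nrm (L y) <= C * nrm x /\ nrm (x - y) <= nrm x / 2.
  have := nrm_ge0 ip x; rewrite le_eqVlt => /orP[/eqP x00|xp].
    by exists 0; rewrite subr0 islin0 // nrm0 // -x00 mulr0 mul0r lexx.
  (* The scaling puts [s x + x0] at distance d/2 from [x0], inside the ball. With [y1] and [y2]
     approximating [s x + x0] and [x0] up to d/8, the vector (y1 - y2) / s misses [x] by at most
     (d/4) / s = |x| / 2, and its image has norm at most 2 n / s = C |x|. *)
  pose s := d / (2 * nrm x); have s0 : 0 < s by rewrite divr_gt0 ?mulr_gt0.
  have sx : s * nrm x = d / 2 by rewrite /s; field; rewrite gt_eqF.
  have e0 : 0 < d / 8 by lra.
  have [|y1 F1 h1] := hd (s%:C *: x + x0) _ _ e0.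
    by rewrite addrK nrmZr // gtr0_norm // sx; lra.
  have [|y2 F2 h2] := hd x0 _ _ e0; first by rewrite subrr nrm0.
  have sV : s%:C * (s^-1)%:C = 1 :> R[i] by rewrite -rmorphM mulfV // gt_eqF.
  exists ((s^-1)%:C *: (y1 - y2)); split.
    rewrite (proj2 hL) islinB // nrmZr // gtr0_norm ?invr_gt0 // ler_pdivrMl //.
    have -> : s * (C * nrm x) = n%:R + n%:R.
      by rewrite mulrCA sx /C; field; rewrite gt_eqF.
    by apply: le_trans (nrmB hI _ _) _; rewrite lerD.
  have hh : nrm (s%:C *: (x - (s^-1)%:C *: (y1 - y2))) <= s * (nrm x / 2).
    rewrite scalerBr scalerA sV scale1r mulrA sx.
    have -> : s%:C *: x - (y1 - y2) = (s%:C *: x + x0 - y1) - (x0 - y2).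
      by rewrite !opprB -!addrA; congr (_ + _); rewrite [RHS]addrC -!addrA addNr addr0 addrC.
    by apply: le_trans (nrmB hI _ _) _; lra.
  by move: hh; rewrite nrmZr // gtr0_norm // ler_pM2l.
have [f hf] := choice half.
exists (2 * C) => x; pose X k := iter k (fun z => z - f z) x.
have hX k : nrm (X k) <= nrm x * 2^-1 ^+ k.
  elim: k => [|k IH]; first by rewrite expr0 mulr1.
  by rewrite /= exprS; case: (hf (X k)) => _ /le_trans; apply; rewrite -/(X k); lra.
(* These are the partial sums of the series of the [L (f (X j))], since [x - X k] is the sum of the
   [f (X j)] for j < k. *)
pose t k := L (x - X k).
have ht k m : nrm (t (k + m)%N - t k) <= 2 * C * nrm x * (2^-1 ^+ k - 2^-1 ^+ (k + m)).
  elim: m => [|m IH]; first by rewrite addn0 !subrr nrm0 // mulr0.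
  apply: le_trans (nrm_dist hI _ (t (k + m)%N) _) _; rewrite addnS.
  have -> : t (k + m).+1 - t (k + m)%N = L (f (X (k + m)%N)).
    by rewrite /t -islinB //= -/(X (k + m)%N); congr L; rewrite !opprB (addrC x) -addrA (addrCA x) subrr addr0 subrK.
  case: (hf (X (k + m)%N)) => h _; have h3 := hX (k + m)%N.
  have {h3}h3 := ler_wpM2l C0 h3; rewrite exprS; lra.
have t0 : t 0%N = 0 by rewrite /t subrr islin0.
have cx0 : 0 <= 2 * C * nrm x by apply: mulr_ge0 (nrm_ge0 _ _); rewrite mulr_ge0 ?C0.
have [y hy] : exists y, tends t y.
  apply: complete => e e0.
  have [|N /(_ N (leqnn _)) hN] := @inv_succ_lt R (e / (2 * C * nrm x + 1)).
    by rewrite divr_gt0 // ltr_wpDl.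
  exists N => k /subnKC <-; apply: le_lt_trans (ht _ _) _.
  rewrite ltr_pdivlMr ?ltr_wpDl // in hN.
  apply: le_lt_trans hN; rewrite mulrC.
  have A0 : 0 < (N.+1%:R : R)^-1 by rewrite invr_gt0 ltr0Sn.
  apply: (@le_trans _ _ (N.+1%:R^-1 * (2 * C * nrm x))); last by rewrite ler_pM2l // lerDl.
  rewrite ler_wpM2r //; apply: le_trans (inv_exp2_le R N).
  by rewrite gerBl exprn_ge0 ?invr_ge0 ?ler0n.
have hs : tends (fun k => x - X k) x.
  apply: (tends_dom (u := fun k => x - X k) (v := fun k => ((2^-1 : R) ^+ k)%:C *: x) (y := 0) (c := 1)).
    move=> k; rewrite addrAC subrr add0r nrmN // subr0 mul1r nrmZr // ger0_norm ?exprn_ge0 ?invr_ge0 ?ler0n //.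
    by rewrite mulrC.
  move=> e e0; have [|N hN] := @inv_succ_lt R (e / (nrm x + 1)).
    by rewrite divr_gt0 // ltr_wpDl ?nrm_ge0.
  exists N => k /hN; rewrite subr0 nrmZr // ger0_norm ?exprn_ge0 ?invr_ge0 ?ler0n //.
  rewrite ltr_pdivlMr ?ltr_wpDl ?nrm_ge0 //; apply: le_lt_trans.
  have A0 : 0 < (k.+1%:R : R)^-1 by rewrite invr_gt0 ltr0Sn.
  apply: (@le_trans _ _ (k.+1%:R^-1 * nrm x)); last by rewrite ler_pM2l // lerDl.
  by rewrite ler_wpM2r ?nrm_ge0 ?inv_exp2_le.
rewrite (clL _ _ _ hs hy); apply: (nrm_lim_le hI hy) => k.
have := ht 0%N k; rewrite t0 subr0 add0n expr0 => /le_trans; apply.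
by rewrite -[leRHS]mulr1 ler_wpM2l // gerBl exprn_ge0 ?invr_ge0 ?ler0n.
Qed.

End Hilbert.

(** * Square roots of positive contractions *)

Section Positive.
Variables (R : realType) (H : lmodType R[i]) (ip : H -> H -> R[i]).
Hypothesis hH : is_hilbert ip.
Local Notation rip := (reip ip).
Local Notation nrm := (hnorm ip).
Local Notation tends := (hlim ip).
Let hI : is_inner_product ip. Proof. by case: hH. Qed.
Let hF : is_form ip. Proof. exact: ip_form. Qed.

Implicit Types p q : {poly R}.

Definition selfadj (L : H -> H) := forall x y, rip (L x) y = rip x (L y).

Variable S : H -> H.
Hypothesis linS : islin S.

(** The polynomial calculus p(S). Coefficients are real, so that p(S) is self-adjoint along with [S]
    and can be positive by the signs of its coefficients. *)
Definition act (p : {poly R}) (x : H) : H := \sum_(i < size p) (p`_i)%:C *: iter i S x.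

Lemma act_wide n p x : (size p <= n)%N -> act p x = \sum_(i < n) (p`_i)%:C *: iter i S x.
Proof.
move=> le_pn; rewrite /act (big_ord_widen n (fun i => (p`_i)%:C *: iter i S x) le_pn) big_mkcond /=.
apply: eq_bigr => i _; case: ifP => // /negbT; rewrite -leqNgt => /(nth_default 0) ->.
by rewrite rmorph0 scale0r.
Qed.

Lemma actD p q x : act (p + q) x = act p x + act q x.
Proof.
rewrite (act_wide x (size_polyD p q)) (act_wide x (leq_maxl (size p) (size q))).
rewrite (act_wide x (leq_maxr (size p) (size q))) -big_split /=.
by apply: eq_bigr => i _; rewrite coefD rmorphD scalerDl.
Qed.

Lemma actZ c p x : act (c *: p) x = c%:C *: act p x.
Proof.
rewrite (act_wide x (size_scale_leq c p)) /act scaler_sumr.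
by apply: eq_bigr => i _; rewrite coefZ rmorphM scalerA.
Qed.

Lemma act0 x : act 0 x = 0. Proof. by rewrite /act size_poly0 big_ord0. Qed.

Lemma actB p q x : act (p - q) x = act p x - act q x.
Proof. by rewrite actD -(scaleN1r q) actZ rmorphN1 scaleN1r. Qed.

Lemma iter_lin n : islin (iter n S).
Proof.
elim: n => [|n [IHD IHZ]]; first by split.
by split=> * /=; rewrite ?IHD ?IHZ ?(proj1 linS) ?(proj2 linS).
Qed.

Lemma act_islin p : islin (act p).
Proof.
split=> [x y|a x].
  rewrite /act -big_split /=; apply: eq_bigr => i _.
  by rewrite (proj1 (iter_lin i)) scalerDr.
rewrite /act scaler_sumr; apply: eq_bigr => i _.
by rewrite (proj2 (iter_lin i)) !scalerA mulrC.
Qed.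

Lemma act_mulX p x : act (p * 'X) x = act p (S x).
Proof.
have le : (size (p * 'X)%R <= (size p).+1)%N by apply: leq_trans (size_polyMleq _ _) _; rewrite size_polyX addn2.
rewrite (act_wide x le) big_ord_recl coefMX eqxx scale0r add0r.
by apply: eq_bigr => i _; rewrite coefMX /= -iterSr.
Qed.

Lemma actX x : act 'X x = S x.
Proof. by rewrite -['X]mul1r act_mulX /act size_poly1 big_ord1 coefC scale1r. Qed.

Lemma act_comm p x : act p (S x) = S (act p x).
Proof.
have hsum n (f : 'I_n -> H) : S (\sum_(i < n) f i) = \sum_(i < n) S (f i).
  by apply: (big_morph S (proj1 linS)); exact: islin0.
rewrite /act hsum; apply: eq_bigr => i _.
by rewrite (proj2 linS) -iterSr.
Qed.

Lemma act_mul p q x : act (p * q) x = act p (act q x).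
Proof.
elim/poly_ind: p x => [|p c IH] x; first by rewrite mul0r !act0.
have hC : act c%:P (act q x) = c%:C *: act q x.
  by rewrite -[c%:P]mulr1 mul_polyC actZ /act size_poly1 big_ord1 coefC /= scale1r.
by rewrite mulrDl !actD -mulrA -(commr_polyX q) mulrA !act_mulX IH act_comm mul_polyC actZ hC.
Qed.

Lemma act_commutes (P : op H) p x : linear_op P ->
  (forall x, dom P x -> dom P (S x) /\ app P (S x) = S (app P x)) ->
  dom P x -> dom P (act p x) /\ app P (act p x) = act p (app P x).
Proof.
move=> [P0 PD PZ PaD PaZ] hP hx.
have Pa0 : app P 0 = 0 by have := PaZ 0 0 P0; rewrite !scale0r.
have hit n : dom P (iter n S x) /\ app P (iter n S x) = iter n S (app P x).
  by elim: n => [|n [d e]] //=; have [d' ->] := hP _ d; rewrite e.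
rewrite /act; elim: (size p) => [|n [d e]]; first by rewrite !big_ord0.
rewrite !big_ord_recr /=; have [d' e'] := hit n; split; first by apply: PD (PZ _ _ d').
by rewrite PaD ?PaZ ?e ?e' //; exact: PZ.
Qed.

Hypothesis adjS : selfadj S.
Hypothesis posS : forall x, 0 <= rip (S x) x.
Hypothesis contrS : forall x, nrm (S x) <= nrm x.

Lemma iter_selfadj n : selfadj (iter n S).
Proof. by elim: n => [|n IH] x y //; rewrite iterSr IH adjS. Qed.

Lemma act_selfadj p : selfadj (act p).
Proof.
move=> x y; rewrite /act; elim: (size p) => [|n IH]; first by rewrite !big_ord0 rip0l // ripC // rip0l.
by rewrite !big_ord_recr /= ripDl // ripDr // IH ripZl // ripZr // iter_selfadj.
Qed.

Definition nneg_coef p := forall i, 0 <= p`_i.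

Lemma nneg_coef0 : nneg_coef 0. Proof. by move=> i; rewrite coef0. Qed.

Lemma nneg_coefX : nneg_coef 'X. Proof. by move=> i; rewrite coefX ler0n. Qed.

Lemma nneg_coefD p q : nneg_coef p -> nneg_coef q -> nneg_coef (p + q).
Proof. by move=> hp hq i; rewrite coefD addr_ge0. Qed.

Lemma nneg_coefM p q : nneg_coef p -> nneg_coef q -> nneg_coef (p * q).
Proof. by move=> hp hq i; rewrite coefM sumr_ge0 // => j _; rewrite mulr_ge0. Qed.

Lemma nneg_coef_half p : nneg_coef p -> nneg_coef (2^-1 *: p).
Proof. by move=> hp i; rewrite coefZ mulr_ge0 ?invr_ge0 ?ler0n. Qed.

(** Every power of [S] is positive: moving half of the factors to the other side leaves [rip y y] or
    [rip (S y) y] with [y] an iterate of [S] on [x]. *)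
Lemma act_pos p x : nneg_coef p -> 0 <= rip (act p x) x.
Proof.
move=> hp; rewrite /act; elim: (size p) => [|n IH].
  by rewrite big_ord0 rip0l.
rewrite big_ord_recr /= ripDl // addr_ge0 // ripZl // mulr_ge0 //.
rewrite -{1}(odd_double_half n) -addnn addnCA iterD iter_selfadj iterD.
by case: (odd n); rewrite ?posS //= rip_ge0.
Qed.

(** Iteration for the solution Y of 2 Y = X + Y^2, where 1 - Y is a square root of 1 - X. It is run
    on polynomials so that monotonicity becomes non-negativity of coefficients. *)
Fixpoint visser n : {poly R} :=
  if n is n'.+1 then 2^-1 *: ('X + visser n' * visser n') else 0.

Lemma visser_nneg n : nneg_coef (visser n).
Proof.
elim: n => [|n IH] /=; first exact: nneg_coef0.
by apply: nneg_coef_half; apply: nneg_coefD nneg_coefX _; apply: nneg_coefM.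
Qed.

(** The recursion gives a difference of squares: each increment is half the previous increment times
    the sum of two iterates. *)
Lemma visser_incr n : nneg_coef (visser n.+1 - visser n).
Proof.
elim: n => [|n IH].
  by rewrite /= mulr0 addr0 subr0; apply: nneg_coef_half nneg_coefX.
have -> : visser n.+2 - visser n.+1 =
    2^-1 *: ((visser n.+1 - visser n) * (visser n.+1 + visser n)).
  rewrite -[visser n.+2]/(2^-1 *: ('X + visser n.+1 * visser n.+1)).
  rewrite -[X in _ - X]/(2^-1 *: ('X + visser n * visser n)).
  by rewrite -scalerBr; congr (_ *: _); move: (visser _) (visser n) => p q; ring.
by apply: nneg_coef_half; apply: nneg_coefM IH _; apply: nneg_coefD; apply: visser_nneg.
Qed.

Lemma visser_mono n k : nneg_coef (visser (n + k) - visser n).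
Proof.
elim: k => [|k IH]; first by rewrite addn0 subrr; apply: nneg_coef0.
have -> : visser (n + k.+1) - visser n =
    (visser (n + k).+1 - visser (n + k)) + (visser (n + k) - visser n).
  by rewrite addnS addrA subrK.
by apply: nneg_coefD IH; apply: visser_incr.
Qed.

Local Notation Y n := (act (visser n)).

Lemma visserE n x : Y n.+1 x = (2^-1 : R)%:C *: (S x + Y n (Y n x)).
Proof. by rewrite /= actZ actD actX act_mul. Qed.

Lemma visser_contr n x : nrm (Y n x) <= nrm x.
Proof.
elim: n x => [|n IH] x; first by rewrite act0 nrm0 ?nrm_ge0.
rewrite visserE nrmZr // ger0_norm ?invr_ge0 ?ler0n //.
have := nrmD hI (S x) (Y n (Y n x)); have := contrS x; have := IH x; have := IH (Y n x); lra.
Qed.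

(** Positivity as a complex number also requires [ip (act p x) x] to be real, which follows from
    self-adjointness. *)
Lemma act_form p : nneg_coef p -> is_form (fun x y => ip (act p x) y).
Proof.
move=> hp; have [linp adjp] := (act_islin p, act_selfadj p); split.
- by move=> a x y z; rewrite (proj1 linp) (proj2 linp) (form_linl hF).
- move=> x y; rewrite -(form_conj hF); apply: form_rip_eq => // a.
  by rewrite adjp (proj2 linp).
- move=> x; rewrite (formE hF) lecE /= act_pos // andbT.
  have := ripiC hF (act p x) x; rewrite (adjp x) (proj2 linp).
  by rewrite (ripC hF ('i *: _) x) => e; apply/eqP; move: e; lra.
Qed.

(** Turns convergence of quadratic forms into convergence in norm. Cauchy-Schwarz for the form of A
    = p(S), at x and A x, reads |A x|^4 <= (A x, x) (A A x, A x), and the last factor is at most 2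
    |A x|^2. *)
Lemma act_sqr_le p x : nneg_coef p -> (forall y, nrm (act p y) <= 2 * nrm y) ->
  rip (act p x) (act p x) <= 2 * rip (act p x) x.
Proof.
move=> hp h2; have t0 := act_pos x hp.
have := CauchySchwarz_sqr (act_form hp) x (act p x); rewrite /reip -/(rip _ _).
rewrite -/(rip (act p x) x) -/(rip (act p (act p x)) (act p x)).
set y := act p x => h; have zn := rip_le hI (act p y) y.
have yy := nrm_sqr hI y; have y0 := nrm_ge0 ip y; have q0 := rip_ge0 hF y.
have zq : rip (act p y) y <= 2 * rip y y.
  apply: le_trans zn _; rewrite -yy expr2 mulrA ler_wpM2r //; exact: h2.
rewrite leNgt; apply/negP => tq; move: h; rewrite leNgt => /negP; apply.
move: t0 q0 zq tq; rewrite -/y; nra.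
Qed.

(** The real sequence [rip (Y n x) x] increases and is bounded by |x|^2; [act_sqr_le] applied to
    differences of iterates, of norm at most 2, makes the vectors themselves Cauchy. *)
Lemma visser_cvg x : exists y, tends (fun n => Y n x) y.
Proof.
have mono n : rip (Y n x) x <= rip (Y n.+1 x) x.
  by rewrite -subr_ge0 -ripBl // -actB act_pos //; exact: visser_incr.
have bnd n : rip (Y n x) x <= nrm x ^+ 2.
  apply: le_trans (rip_le hI _ _) _; have := visser_contr n x.
  have := nrm_ge0 ip x; nra.
apply: (complete hH) => e e0.
have e2 : 0 < e ^+ 2 / 2 by rewrite divr_gt0 ?exprn_gt0.
have [N hN] := monotone_bounded_cauchy mono bnd e2; exists N => n Nn.
have /andP[_] := hN n Nn; rewrite -(subnKC Nn) -actB.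
have hp := visser_mono N (n - N)%N.
have := act_sqr_le x hp; set p := visser _ - _ in hp *.
have -> : rip (Y (N + (n - N)) x) x = rip (act p x) x + rip (Y N x) x.
  by rewrite /p actB ripBl // subrK.
rewrite -(nrm_sqr hI) => h h1.
rewrite -ltr_sqr ?nnegrE ?nrm_ge0 ?(ltW e0) //; apply: le_lt_trans (h _) _; last lra.
move=> y; rewrite /p actB; apply: le_trans (nrmB hI _ _) _.
by have := visser_contr (N + (n - N)) y; have := visser_contr N y; lra.
Qed.

(* The Visser iterates increase to the solution Y of 2 Y = S + Y^2, so that
   (1 - Y)^2 = 1 - S. *)
Lemma sqrt_exists : exists M : H -> H,
  [/\ islin M, selfadj M, forall x, 0 <= rip (M x) x, forall x, M (M x) = x - S x
    & bounded_by ip 2 M /\ forall P : op H, linear_op P -> closed_op ip P ->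
      (forall x, dom P x -> dom P (S x) /\ app P (S x) = S (app P x)) ->
      forall x, dom P x -> dom P (M x) /\ app P (M x) = M (app P x)].
Proof.
have [L hL] := choice visser_cvg.
have linL : islin L.
  split=> [x y|a x]; apply: (tends_unique hI (hL _)).
    rewrite (_ : (fun n => _) = fun n => Y n x + Y n y); first exact: tendsD.
    by apply/funext => n; rewrite (proj1 (act_islin _)).
  rewrite (_ : (fun n => _) = fun n => a *: Y n x); first exact: tendsZ.
  by apply/funext => n; rewrite (proj2 (act_islin _)).
have contrL x : nrm (L x) <= nrm x by apply: (nrm_lim_le hI (hL x)) => n; apply: visser_contr.
have adjL : selfadj L.
  by move=> x y; apply: (rip_lim hI (hL x) (hL y)) => n; apply: act_selfadj.
have LL x : L x + L x = S x + L (L x).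
  apply: (tends_unique hI (u := fun n => Y n.+1 x + Y n.+1 x)).
    by apply: tendsD => // e e0; have [N hN] := hL x e e0; exists N => n Nn; apply: hN; exact: leqW.
  rewrite (_ : (fun n => _) = fun n => S x + Y n (Y n x)).
    apply: (tendsD hI (tends_cst hI _)).
    (* Splitting Y_n Y_n x as Y_n (Y_n x - L x) + Y_n (L x): the first term tends to 0 because every
       Y_n is a contraction. *)
    have := tendsD hI (u := fun n => Y n (Y n x - L x)) (v := fun n => Y n (L x)) (x := 0) _ (hL (L x)).
    rewrite add0r (_ : (fun n => _ + _) = fun n => Y n (Y n x)); first apply.
      by apply: (tends_dom (c := 1) _ (hL x)) => n; rewrite subr0 mul1r visser_contr.
    by apply/funext => n; rewrite islinB ?subrK //; exact: act_islin.
  apply/funext => n; rewrite visserE -scalerDl -rmorphD.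
  by rewrite (_ : _ + _ = 1) ?scale1r //; lra.
exists (fun x => x - L x); split.
- split=> [x y|a x]; first by rewrite (proj1 linL) opprD addrACA.
  by rewrite (proj2 linL) scalerBr.
- by move=> x y; rewrite ripBl // ripBr // adjL.
- move=> x; rewrite ripBl // subr_ge0; apply: le_trans (rip_le hI _ _) _.
  by rewrite -nrm_sqr // expr2 ler_wpM2r ?nrm_ge0.
- move=> x; rewrite islinB // opprB -addrA; congr (_ + _).
  by rewrite addrCA -opprD LL opprD addrCA subrr addr0.
- split=> [x|P linP clP hP x dx].
    by apply: le_trans (nrmB hI _ _) _; have := contrL x; lra.
  have hn n := act_commutes (visser n) linP hP dx.
  have [d e] : dom P (L x) /\ app P (L x) = L (app P x).
    apply: (clP (fun n => Y n x)); first by move=> n; case: (hn n).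
      by apply/(cvg_tends hI).
    apply/(cvg_tends hI); rewrite (_ : (fun n => _) = fun n => Y n (app P x)) //.
    by apply/funext => n; case: (hn n).
  case: linP => _ PD PZ PaD PaZ; have dN : dom P (- L x) by rewrite -scaleN1r; apply: PZ.
  split; first exact: PD.
  by rewrite PaD // -scaleN1r PaZ // e scaleN1r.
Qed.

End Positive.

(** * Spectral subspaces of a positive contraction *)

Section Spectral.
Variables (R : realType) (H : lmodType R[i]) (ip : H -> H -> R[i]).
Hypothesis hH : is_hilbert ip.
Local Notation rip := (reip ip).
Local Notation nrm := (hnorm ip).
Local Notation tends := (hlim ip).
Let hI : is_inner_product ip. Proof. by case: hH. Qed.
Let hF : is_form ip. Proof. exact: ip_form. Qed.

Variables (B : H -> H) (e : R).
Hypotheses (linB : islin B) (adjB : selfadj ip B).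
Hypothesis (contrB : forall x, rip (B x) (B x) <= rip (B x) x).
Hypothesis (injB : forall x, B x = 0 -> x = 0).
Hypothesis (he : 0 < e <= 2^-1).

Definition commutes_with (P : op H) :=
  forall x, dom P x -> dom P (B x) /\ app P (B x) = B (app P x).

(** The square root construction is applied to S = 1 - A^2, whose associated root of 1 - S = A^2 is
    the absolute value of A. *)
Let A x := B x - e%:C *: x.
Let S x := x - A (A x).

Let linA : islin A.
Proof.
split=> [x y|a x]; rewrite /A ?(proj1 linB) ?(proj2 linB).
  by rewrite scalerDr opprD addrACA.
by rewrite scalerBr !scalerA mulrC.
Qed.

Let adjA : selfadj ip A.
Proof. by move=> x y; rewrite /A !ripE // adjB. Qed.

(** Since 0 <= B <= 1, the bound e <= 1/2 yields |A x|^2 <= (1 - 2 e) (B x, x) + e^2 |x|^2 <= (1 -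
    e)^2 |x|^2. *)
Let contrA x : rip (A x) (A x) <= rip x x.
Proof.
have /andP[e0 e1] := he; have pq := contrB x; have p0 := rip_ge0 hF (B x).
have := rip_ge0 hF (x - B x); rewrite /A !ripE // (ripC hF x (B x)).
move: (rip (B x) (B x)) (rip (B x) x) (rip x x) pq p0 => p q t pq p0 tq.
have h1 : 0 <= (1 - 2 * e) * (t - q) by rewrite mulr_ge0 //; lra.
have h2 : 0 <= e * (2 - e) * t by rewrite !mulr_ge0 //; lra.
lra.
Qed.

Let linS : islin S.
Proof.
split=> [x y|a x]; rewrite /S !(proj1 linA, proj2 linA).
  by rewrite opprD addrACA.
by rewrite scalerBr.
Qed.

Let adjS : selfadj ip S.
Proof. by move=> x y; rewrite /S ripBl // ripBr // adjA adjA. Qed.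

Let posS x : 0 <= rip (S x) x.
Proof. by rewrite /S ripBl // adjA subr_ge0. Qed.

(** Expanding, |S x|^2 = |x|^2 - 2 |A x|^2 + |A A x|^2, and the last term is at most |A x|^2. *)
Let contrS x : nrm (S x) <= nrm x.
Proof.
have := contrA (A x); have := adjA (A x) x; have := rip_ge0 hF (A x).
rewrite nrm_le // /S; move: (A (A x)) => z a0 az zz.
by rewrite !ripE // (ripC hF x z) az; lra.
Qed.

Let op_all (L : H -> H) : op H := Op (fun=> True) L.

Let commS P : linear_op P -> commutes_with P ->
  forall x, dom P x -> [/\ dom P (A x), app P (A x) = A (app P x),
    dom P (S x) & app P (S x) = S (app P x)].
Proof.
move=> [P0 PD PZ PaD PaZ] hP.
have opB x y : dom P x -> dom P y -> dom P (x - y) /\ app P (x - y) = app P x - app P y.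
  move=> dx dy; have dNy : dom P (- y) by rewrite -scaleN1r; exact: PZ.
  by split; [exact: PD | rewrite PaD // -(scaleN1r y) PaZ // scaleN1r].
have hA x : dom P x -> dom P (A x) /\ app P (A x) = A (app P x).
  move=> dx; have [dB eB] := hP _ dx; have [d1 e1] := opB _ _ dB (PZ e%:C _ dx).
  by split; rewrite // e1 eB PaZ.
move=> x dx; have [d1 e1] := hA _ dx; have [d2 e2] := hA _ d1; have [d3 e3] := opB _ _ dx d2.
by split; rewrite // e3 e2 e1.
Qed.

(** With [M] the positive root of A^2, take W = ker (M - A). There A = M >= 0, so B >= e; on the
    orthogonal complement of W one has A = - M <= 0, so B <= e. Invariance comes from [M] commuting
    with whatever closed operator commutes with [B]. *)
Lemma spectral_split : exists W : H -> Prop,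
  [/\ subspace W,
      forall w, W w -> W (B w),
      forall w, W w -> exists w', [/\ W w', B w' = w & nrm w' <= e^-1 * nrm w],
      forall P, linear_op P -> closed_op ip P -> commutes_with P ->
        forall w, W w -> dom P w -> W (app P w)
    & forall v, (forall w, W w -> rip v w = 0) -> rip (B v) v <= e * rip v v].
Proof.
have [M [linM adjM posM MM [bM commM]]] := sqrt_exists hH linS adjS posS contrS.
have /andP[e0 e1] := he.
have linall : linear_op (op_all B) by split=> // *; rewrite /= ?(proj1 linB) ?(proj2 linB).
have bB : bounded_by ip 1 B.
  move=> x; rewrite mul1r; apply: nrm_le_sqr (nrm_ge0 _ _) _ => //.
  have := contrB x; have := rip_le hI (B x) x; rewrite -(nrm_sqr hI (B x)).
  have := nrm_ge0 ip x; have := nrm_ge0 ip (B x); nra.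
have bA : bounded_by ip 1 A by move=> x; rewrite mul1r nrm_le.
have clall : closed_op ip (op_all B).
  move=> u x y _ /(cvg_tends hI) hx /(cvg_tends hI) hy; split=> //=.
  exact: (tends_unique hI (lin_tends linB bB hx) hy).
(* The commutation clause of the square root is applied to [B] itself, viewed as an everywhere
   defined closed operator. *)
have MB x : B (M x) = M (B x).
  have [] // := commM _ linall clall _ x I.
  by move=> y _; have [] // := commS linall _ (x := y).
have MA x : M (A x) = A (M x) by rewrite /A islinB // MB (proj2 linM).
pose W x := M x = A x.
have sW : subspace W.
  split; rewrite /W; first by rewrite !islin0.
    by move=> x y hx hy; rewrite (proj1 linM) (proj1 linA) hx hy.
  by move=> a x hx; rewrite (proj2 linM) (proj2 linA) hx.
have WB w : W w -> W (B w).
  by rewrite /W -MB => ->; rewrite /A islinB // (proj2 linB).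
have lowB w : W w -> e * rip w w <= rip (B w) w.
  by move=> hw; have := posM w; rewrite hw /A ripBl // ripZl // subr_ge0.
have lowN w : W w -> e * nrm w <= nrm (B w).
  move=> hw; have := lowB w hw; have := rip_le hI (B w) w; rewrite -nrm_sqr //.
  have := nrm_ge0 ip w; rewrite le_eqVlt => /orP[/eqP <-|w0]; first by move=> _ _; rewrite mulr0 nrm_ge0.
  by move=> h1 h2; have := le_trans h2 h1; rewrite expr2 mulrA ler_pM2r.
have Wcl u x : (forall n, W (u n)) -> tends u x -> W x.
  move=> hu hx; apply: (tends_unique hI (lin_tends linM bM hx)).
  rewrite (_ : (fun n => _) = fun n => A (u n)); first exact: (lin_tends linA bA).
  by apply/funext => n; exact: hu.
exists W; split=> //.
(* [B] maps W onto W: the part [w - p] of [w] orthogonal to B W lies in W, so it is orthogonal to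
   its own image under [B] and vanishes by [lowB]. Preimages of points tending to [w] are Cauchy
   because [lowN] bounds [B] below. *)
- move=> w hw; pose BW x := exists2 y, W y & x = B y.
  have sBW : subspace BW.
    have [W0 WD WZ] := sW; split; first by exists 0; rewrite ?islin0.
      by move=> _ _ [x hx ->] [y hy ->]; exists (x + y); [exact: WD | rewrite (proj1 linB)].
    by move=> a _ [x hx ->]; exists (a *: x); [exact: WZ | rewrite (proj2 linB)].
  have [u [p [hu up orth]]] := projection hH w sBW.
  have [v hv] := choice (fun n => match hu n with ex_intro2 y h1 h2 => ex_intro (fun y => W y /\ u n = B y) y (conj h1 h2) end).
  have uW n : W (u n) by have [? ->] := hv n; exact: WB.
  have Wz : W (w - p) by apply: subspaceB => //; exact: Wcl up.
  have wp : w = p.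
    apply/eqP; rewrite -subr_eq0; apply/eqP; apply: (rip_eq0 hI).
    have := lowB _ Wz; rewrite (ripC hF (B _)) (orth (B _)); last by exists (w - p).
    by rewrite pmulr_rle0 // => z0; apply: le_anti; rewrite z0 rip_ge0.
  have [w' hw'] : exists w', tends v w'.
    apply: (complete hH) => d d0; have [|N hN] := up (e * d / 2); first by rewrite divr_gt0 ?mulr_gt0.
    exists N => n Nn; have := lowN (v n - v N) (subspaceB sW (proj1 (hv n)) (proj1 (hv N))).
    rewrite islinB // -(proj2 (hv n)) -(proj2 (hv N)) => h.
    have := nrm_dist hI (u n) p (u N); rewrite (nrmBC hI p) => h'.
    have := hN _ Nn; have := hN _ (leqnn N) => h1 h2.
    rewrite -(ltr_pM2l e0); lra.
  have Bw' : B w' = w.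
    rewrite wp; apply: (tends_unique hI (lin_tends linB bB hw')).
    by rewrite (_ : (fun n => _) = u) //; apply/funext => n; have [_ ->] := hv n.
  have Ww' : W w' by apply: Wcl hw' => n; case: (hv n).
  by exists w'; split=> //; rewrite ler_pdivlMl // -Bw' lowN.
- move=> P linP clP hP w hw dw; rewrite /W.
  have [d1 e1' d2 e2] := commS linP hP dw.
  have [|_ <-] := commM P linP clP _ w dw; last by rewrite hw e1'.
  by move=> x dx; have [] := commS linP hP dx.
(* As (M - A) (M + A) = M^2 - A^2 = 0, the range of M + A lies in W; for [v] orthogonal to W this
   gives |(M + A) v|^2 = (v, (M + A)^2 v) = 0. *)
- move=> v hv; have hMA : M v + A v = 0.
    apply: (rip_eq0 hI); set z := M v + A v; rewrite {1}/z ripDl // adjM adjA -ripDr //.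
    by apply: hv; rewrite /W (proj1 linM) (proj1 linA) MM MA /S subKr addrC.
  have := posM v; move/eqP: hMA; rewrite addr_eq0 => /eqP ->.
  by rewrite /A !ripE //; lra.
Qed.

End Spectral.

(** * Cauchy's estimate and Fuglede's theorem *)

Lemma prim_root_exists (F : numClosedFieldType) K : (0 < K)%N -> exists w : F, K.-primitive_root w.
Proof.
move=> K0; have [r Dp] := closed_field_poly_normal ('X^K - 1 : {poly F}).
move: Dp; rewrite lead_coefXnsubC // scale1r => Dp.
have rn1 : all K.-unity_root r by apply/allP=> z; rewrite -root_prod_XsubC -Dp.
have sz_r : (K < (size r).+1)%N by rewrite -(size_prod_XsubC r id) -Dp size_XnsubC.
have [|z] := hasP (has_prim_root K0 rn1 _ sz_r); last by exists z.
by rewrite -separable_prod_XsubC -Dp separable_Xn_sub_1 // pnatr_eq0 -lt0n.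
Qed.

(** Discrete orthogonality that extracts the linear coefficient of a polynomial. The terms form a
    geometric series of ratio w^(k-1), and w^k differs from w for every other k < K, including k =
    0. *)
Lemma sum_prim_root (F : fieldType) K (w : F) k : K.-primitive_root w -> (1 < K)%N -> (k < K)%N ->
  \sum_(j < K) (w ^+ j)^-1 * (w ^+ j) ^+ k = if k == 1%N then K%:R else 0.
Proof.
move=> hw K1 kK.
have w0 : w != 0 by rewrite (prim_root_eq0 hw) -lt0n ltnW.
have -> : \sum_(j < K) (w ^+ j)^-1 * (w ^+ j) ^+ k = \sum_(j < K) (w ^+ k / w) ^+ j.
  by apply: eq_bigr => j _; rewrite exprMn exprVn -!exprM mulrC (mulnC k).
case: eqP => [->|/eqP k1].
  by rewrite divff // (eq_bigr (fun=> 1)) ?sumr_const ?card_ord // => j _; rewrite expr1n.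
have z1 : w ^+ k / w - 1 != 0.
  rewrite subr_eq0 -(inj_eq (mulIf w0)) divfK // mul1r -{2}[w]expr1 (eq_prim_root_expr hw).
  by rewrite !modn_small.
apply: (mulfI z1); rewrite mulr0 -subrX1 exprMn exprVn -exprM mulnC exprM.
by rewrite (prim_expr_order hw) expr1n invr1 mulr1 subrr.
Qed.

(** Chooses the truncation degree of the Neumann series so that the error factors of its n-th power
    multiply to at most 2. The bound (1 + e)^k <= 1 + 3^k e for 0 <= e <= 1 suffices. *)
Lemma pow1D_le2 (R : realType) n : exists m, (1 + 2^-1 ^+ m.+2 : R) ^+ n <= 2.
Proof.
have bern (e : R) k : 0 <= e <= 1 -> (1 + e) ^+ k <= 1 + 3 ^+ k * e.
  move=> /andP[e0 e1]; elim: k => [|k IH]; first by rewrite !expr0 mul1r lerDl.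
  have p1 : 1 <= (3 : R) ^+ k by rewrite exprn_ege1 // ler1n.
  rewrite exprS; apply: le_trans (ler_wpM2l _ IH) _; first by rewrite addr_ge0.
  rewrite exprS; move: (3 ^+ k) p1 => p p1; have : 0 <= p * e * (1 - e) by rewrite !mulr_ge0 //; lra.
  by have : e <= p * e; [rewrite ler_peMl | lra].
have p0 : 0 < (3 : R) ^+ n by rewrite exprn_gt0.
have [|N /(_ N (leqnn _)) hN] := @inv_succ_lt R (3 ^+ n)^-1; first by rewrite invr_gt0.
have e0 k : 0 <= (2^-1 : R) ^+ k by rewrite exprn_ge0 ?invr_ge0 ?ler0n.
have e1 : (2^-1 : R) ^+ N.+2 <= (3 ^+ n)^-1.
  apply: le_trans (ltW hN); apply: le_trans (inv_exp2_le R N).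
  by rewrite !exprS; have := e0 N; lra.
exists N; apply: le_trans (bern _ _ _) _.
  by rewrite e0 exprn_ile1 ?invr_ge0 ?ler0n // invf_le1 // ler1n.
have : 3 ^+ n * (2^-1 : R) ^+ N.+2 <= 1 by rewrite -ler_pdivlMl // mulr1.
lra.
Qed.

Section Fuglede.
Variables (R : realType) (H : lmodType R[i]) (ip : H -> H -> R[i]).
Hypothesis hI : is_inner_product ip.
Local Notation nrm := (hnorm ip).

Definition lin_on (V : H -> Prop) (L : H -> H) :=
  (forall x y, V x -> V y -> L (x + y) = L x + L y) /\
  (forall (a : R[i]) x, V x -> L (a *: x) = a *: L x).

Lemma lin_on0 V L : subspace V -> lin_on V L -> L 0 = 0.
Proof. by case=> V0 _ _ [_ LZ]; have := LZ 0 0 V0; rewrite !scale0r. Qed.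

Lemma lin_onN V L x : lin_on V L -> V x -> L (- x) = - L x.
Proof. by case=> _ LZ Vx; rewrite -scaleN1r LZ // scaleN1r. Qed.

Lemma lin_onMn V L x n : subspace V -> lin_on V L -> V x -> L (x *+ n) = L x *+ n.
Proof. by move=> sV [_ LZ] Vx; rewrite -(scaler_nat n x) -(scaler_nat n (L x)) LZ. Qed.

Lemma lin_on_sum V L d (h : nat -> H) : subspace V -> lin_on V L -> (forall k, V (h k)) ->
  L (\sum_(k < d) h k) = \sum_(k < d) L (h k).
Proof.
move=> sV lV hV; elim: d => [|d IH]; first by rewrite !big_ord0 (lin_on0 sV).
by rewrite !big_ord_recr /= (proj1 lV) ?IH //; exact: (@subspace_sum _ _ V).
Qed.

(* [f] is an H-valued polynomial with coefficients in [V], those of degree 0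
   and 1 being [a] and [b]. *)
Definition polyfun (V : H -> Prop) (f : R[i] -> H) (a b : H) :=
  exists2 h : nat -> H, [/\ forall k, V (h k), h 0%N = a & h 1%N = b] &
    exists d, forall n, (d <= n)%N -> forall mu, f mu = \sum_(k < n) mu ^+ k *: h k.

Lemma polyfun_cst V x : subspace V -> V x -> polyfun V (fun=> x) x 0.
Proof.
move=> [V0 _ _] Vx; exists (fun k => if k is 0%N then x else 0); first by split=> // -[].
exists 1%N => -[|n] // _ mu; rewrite big_ord_recl expr0 scale1r big1 ?addr0 // => k _.
by rewrite scaler0.
Qed.

(** Multiplication by [mu] shifts coefficients, so the new linear coefficient sees only the constant
    coefficient of [g]. *)
Lemma polyfun_stepD V f g a b a' b' s : subspace V -> lin_on V s -> (forall x, V x -> V (s x)) ->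
  polyfun V f a b -> polyfun V g a' b' -> polyfun V (fun mu => f mu + mu *: s (g mu)) a (b + s a').
Proof.
move=> sV ls Vs [h [Vh <- <-] [d hd]] [h' [Vh' <- _] [d' hd']]; have [V0 VD VZ] := sV.
exists (fun k => h k + if k is k'.+1 then s (h' k') else 0).
  by split=> [[|k]||] //; rewrite ?addr0 //; apply: VD; auto.
exists (maxn d d').+1 => -[|n] //; rewrite ltnS geq_max => /andP[dn dn'] mu.
rewrite (hd n.+1 (leqW dn)) (hd' n dn') (lin_on_sum _ sV ls (h := fun k => mu ^+ k *: h' k)); last by auto.
rewrite [in RHS](eq_bigr (fun k : 'I_n.+1 => mu ^+ k *: h k +
  mu ^+ k *: if val k is k'.+1 then s (h' k') else 0)); last by move=> k _; rewrite scalerDr.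
rewrite big_split /=; congr (_ + _); rewrite big_ord_recl /= scaler0 add0r scaler_sumr.
by apply: eq_bigr => k _; rewrite (proj2 ls) // scalerA -exprS.
Qed.

Lemma polyfun_lin V W f a b L : subspace V -> lin_on V L -> (forall x, V x -> W (L x)) ->
  polyfun V f a b -> polyfun W (fun mu => L (f mu)) (L a) (L b).
Proof.
move=> sV lL VW [h [Vh <- <-] [d hd]]; exists (fun k => L (h k)); first by split=> // k; auto.
have [_ _ VZ] := sV; exists d => n dn mu.
rewrite (hd n dn) (lin_on_sum _ sV lL (h := fun k => mu ^+ k *: h k)); last by auto.
by apply: eq_bigr => k _; rewrite (proj2 lL).
Qed.

Lemma cauchy_estimate V f a b (rho M : R) : polyfun V f a b -> 0 <= rho ->
  (forall mu, `|mu| = rho%:C -> nrm (f mu) <= M) -> rho * nrm b <= M.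
Proof.
(* [K] is at least the number of coefficients, so that averaging over the [K]-th roots of unity is
   exact, and it exceeds 1, so that index 1 is in range. *)
move=> [h [_ _ <-] [d hd]] rho0 hM; pose K := d.+2.
have [w hw] := @prim_root_exists R[i] K isT.
have normw : `|w| = 1.
  apply/eqP; rewrite -(@pexpr_eq1 _ _ K) ?normr_ge0 // -normrX (prim_expr_order hw) normr1.
  exact: eqxx.
have normwj j : `|w ^+ j| = 1 by rewrite normrX normw expr1n.
have : \sum_(j < K) (w ^+ j)^-1 *: f (rho%:C * w ^+ j) = (K%:R * rho%:C) *: h 1%N.
  rewrite (eq_bigr (fun j : 'I_K => \sum_(k < K)
     (((w ^+ j)^-1 * (w ^+ j) ^+ k) * rho%:C ^+ k) *: h k)); last first.
    move=> j _; rewrite (hd K) ?scaler_sumr; last by rewrite /K !leqW.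
    by apply: eq_bigr => k _; rewrite scalerA exprMn mulrAC mulrA.
  rewrite exchange_big /= (bigD1 (inord 1 : 'I_K)) //= [X in _ + X]big1 ?addr0.
    by rewrite -scaler_suml -mulr_suml inordK // sum_prim_root // eqxx expr1.
  move=> k k1; rewrite -scaler_suml -mulr_suml sum_prim_root // ifN ?mul0r ?scale0r //.
  by apply: contraNneq k1 => e; apply/eqP/val_inj; rewrite /= inordK.
move=> e; have K0 : 0 < (K%:R : R) by rewrite ltr0Sn.
rewrite -(ler_pM2l K0) mulrA.
have -> : K%:R * rho * nrm (h 1%N) = nrm ((K%:R * rho%:C) *: h 1%N).
  by rewrite -(rmorph_nat (real_complex R)) -rmorphM nrmZr // ger0_norm // mulr_ge0 // ltW.
rewrite -e; apply: le_trans (nrm_sum hI K (fun j => (w ^+ j)^-1 *: f (rho%:C * w ^+ j))) _.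
have -> : K%:R * M = \sum_(j < K) M by rewrite sumr_const card_ord mulr_natl.
apply: ler_sum => j _; rewrite nrmZ // normfV normwj invr1 mul1r; apply: hM.
by rewrite normrM normwj mulr1 normc_def /= expr0n addr0 sqrtr_sqr ger0_norm.
Qed.

(** * Fuglede's theorem on an invariant subspace where the operators are bounded *)

Section Bounded.
Variables (n s T : H -> H) (V Z : H -> Prop) (c r : R).
Hypotheses (sV : subspace V) (sZ : subspace Z) (VZ : forall x, V x -> Z x).
Hypotheses (ln : lin_on Z n) (ls : lin_on Z s) (lT : lin_on V T).
Hypotheses (Vn : forall x, V x -> V (n x)) (Vs : forall x, V x -> V (s x)).
Hypotheses (Zn : forall x, Z x -> Z (n x)) (Zs : forall x, Z x -> Z (s x)).
Hypothesis (ns : forall x, Z x -> n (s x) = s (n x)).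
Hypothesis (adj : forall x y, Z x -> Z y -> ip (n x) y = ip x (s y)).
Hypotheses (VT : forall x, V x -> Z (T x)) (Tn : forall x, V x -> T (n x) = n (T x)).
Hypotheses (Tc : forall x, V x -> nrm (T x) <= c * nrm x).
Hypotheses (sr : forall x, V x -> nrm (s x) <= r * nrm x).

(** On [Z], the operator [A mu] is 1 + mu s and [A' mu] is its adjoint 1 + conj(mu) n. *)
Let stepA (L : H -> H) (mu : R[i]) w := w + mu *: L w.
Let A mu := stepA s mu.
Let A' mu := stepA n mu^*.

(* [geo m mu] is the Neumann series of [(1 + mu s)^-1] truncated at degree [m]. *)
Fixpoint geo m (mu : R[i]) w := if m is m'.+1 then w - mu *: s (geo m' mu w) else w.

Let lsV : lin_on V s. Proof. by split=> *; [apply: (proj1 ls) | apply: (proj2 ls)]; auto. Qed.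

Let stab_stepA U L mu w : subspace U -> (forall x, U x -> U (L x)) -> U w -> U (stepA L mu w).
Proof. by move=> [_ UD UZ] UL Uw; apply: UD => //; apply: UZ; apply: UL. Qed.

Let stab_iter U (f : H -> H) k w : (forall x, U x -> U (f x)) -> U w -> U (iter k f w).
Proof. by move=> Uf Uw; elim: k => //= k; exact: Uf. Qed.

Let stab_geo m mu w : V w -> V (geo m mu w).
Proof.
by move=> Vw; have [_ _ VZ'] := sV; elim: m => //= m IH; apply: subspaceB => //; apply: VZ'; apply: Vs.
Qed.

Let comm_iter U (f g : H -> H) k w : (forall x, U x -> U (f x)) ->
  (forall x, U x -> f (g x) = g (f x)) -> U w -> iter k f (g w) = g (iter k f w).
Proof. by move=> Uf fg Uw; elim: k => //= k ->; apply: fg; exact: stab_iter. Qed.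

Let A_comm mu w : Z w -> A' mu (A mu w) = A mu (A' mu w).
Proof.
move=> Zw; have [_ ZD ZZ] := sZ; rewrite /A /A' /stepA.
rewrite (proj1 ln) ?(proj1 ls) ?(proj2 ln) ?(proj2 ls) ?ns //; auto.
by rewrite !scalerDr !scalerA (mulrC mu) !addrA (addrAC w).
Qed.

(** This is normality: [n w] and [s w] have the same norm, and the two cross terms have equal real
    parts. *)
Let nrm_A mu w : Z w -> nrm (A mu w) = nrm (A' mu w).
Proof.
move=> Zw; have [_ ZD ZZ] := sZ; have hF := ip_form hI.
have h1 : reip ip (n w) (n w) = reip ip (s w) (s w).
  rewrite {1}/reip adj; auto.
  by rewrite -ns // -/(reip ip w (n (s w))) ripC // {1}/reip adj; auto.
have h2 : reip ip (mu *: s w) w = reip ip (mu^* *: n w) w.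
  rewrite /reip !formZl // adj // (form_conj hF w).
  by case: (ip (s w) w) (mu) => p q [x y] /=; ring.
rewrite /hnorm /A /A' /stepA !ripE // (ripC hF w) h2 (ripC hF w) !rip_scale // h1.
by rewrite normcJ.
Qed.

(** One factor is exchanged at a time, the exchanged ones being moved inside by [A_comm]. *)
Let nrm_iterA mu k w : Z w -> nrm (iter k (A mu) w) = nrm (iter k (A' mu) w).
Proof.
have ZA x : Z x -> Z (A mu x) by apply: stab_stepA.
have ZA' x : Z x -> Z (A' mu x) by apply: stab_stepA.
elim: k w => //= k IH w Zw; rewrite nrm_A; last exact: stab_iter.
rewrite -(comm_iter (U := Z) (f := A mu)) //; last by move=> x Zx; rewrite A_comm.
by rewrite IH; auto; rewrite -iterS iterSr.
Qed.

Let s_A mu w : V w -> s (A mu w) = A mu (s w).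
Proof. by move=> Vw; have [_ _ VZ'] := sV; rewrite /A /stepA (proj1 lsV) ?(proj2 lsV) //; auto. Qed.

Let A_geo m mu w : V w -> A mu (geo m mu w) = geo m mu (A mu w).
Proof.
move=> Vw; have [_ _ VZ'] := sV; elim: m => //= m IH.
have Vg := stab_geo m mu Vw.
rewrite -IH s_A // /A /stepA (proj1 lsV) ?(lin_onN lsV) ?(proj2 lsV) //; auto.
  by rewrite !scalerDr !scalerN opprD -!addrA; congr (_ + _); rewrite addrCA.
by apply: subspaceN; auto.
Qed.

(** The truncation error 1 - (1 + mu s) geo_m is the power (- mu s)^(m+1), of norm at most
    2^-(m+1). *)
Let nrm_A_geo m mu w : V w -> (forall x, V x -> nrm (mu *: s x) <= 2^-1 * nrm x) ->
  nrm (A mu (geo m mu w)) <= (1 + 2^-1 ^+ m.+1) * nrm w.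
Proof.
move=> Vw h2; have [_ _ VZ'] := sV.
suff : nrm (w - A mu (geo m mu w)) <= 2^-1 ^+ m.+1 * nrm w.
  have := nrmB hI w (w - A mu (geo m mu w)); rewrite opprB addrC subrK; lra.
elim: m => [|m IH].
  by rewrite expr1 /= /A /stepA opprD addrA subrr add0r nrmN //; exact: h2.
have Vg := stab_geo m mu Vw; have VA : V (A mu (geo m mu w)) by exact: (stab_stepA mu sV Vs Vg).
have -> : w - A mu (geo m.+1 mu w) = - (mu *: s (w - A mu (geo m mu w))).
  rewrite (proj1 lsV) ?(lin_onN lsV) ?s_A //; last exact: subspaceN.
  rewrite /= {1}/A /stepA (proj1 lsV) ?(lin_onN lsV) ?(proj2 lsV); auto; last by apply: subspaceN; auto.
  by rewrite /A /stepA !scalerDr !scalerN scalerDr !opprD !opprK !addrA subrr add0r addrAC (addrC _ (- _)) !addrA.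
rewrite nrmN // exprS -mulrA; apply: le_trans (h2 _ _) _; first exact: subspaceB.
by rewrite ler_wpM2l ?invr_ge0 ?ler0n.
Qed.

Let nrm_iter_A_geo m mu k w : V w -> (forall x, V x -> nrm (mu *: s x) <= 2^-1 * nrm x) ->
  nrm (iter k (A mu) (iter k (geo m mu) w)) <= (1 + 2^-1 ^+ m.+1) ^+ k * nrm w.
Proof.
have VA x : V x -> V (A mu x) by apply: stab_stepA.
move=> + h2; elim: k w => [|k IH] w Vw; first by rewrite expr0 mul1r.
have -> : iter k.+1 (A mu) (iter k.+1 (geo m mu) w) =
    iter k (A mu) (iter k (geo m mu) (A mu (geo m mu w))).
  rewrite iterSr; congr (iter k _ _); rewrite iterSr (comm_iter (U := V) (f := geo m mu) (g := A mu)) //.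
  - by move=> x Vx; exact: stab_geo.
  - by move=> x Vx; rewrite A_geo.
  - exact: stab_geo.
apply: le_trans (IH _ _) _; first by apply: VA; exact: stab_geo.
by rewrite (exprSr (1 + _)) -mulrA ler_wpM2l ?nrm_A_geo // exprn_ge0 // addr_ge0 // exprn_ge0 // invr_ge0 ler0n.
Qed.

(** The degree is [m.+1] because the series truncated at degree 0 lacks the linear term - mu s; each
    of the [k] factors contributes one [- s x]. *)
Let poly_geo m k x : V x ->
  polyfun V (fun mu => iter k (geo m.+1 mu) x) x (- (s x *+ k)).
Proof.
move=> Vx; have [V0 VD VZ'] := sV.
have ls' : lin_on V (fun x => - s x).
  by split=> *; rewrite ?(proj1 lsV) ?(proj2 lsV) ?opprD ?scalerN.
have Vs' y : V y -> V (- s y) by move=> Vy; apply: subspaceN; auto.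
(* The linear coefficient is left unspecified, as [polyfun_stepD] passes on only the constant
   one. *)
have one q f a b : polyfun V f a b -> exists b', polyfun V (fun mu => geo q mu (f mu)) a b'.
  move=> pf; elim: q => [|q [b' pb']]; first by exists b.
  exists (b + - s a); have := polyfun_stepD sV ls' Vs' pf pb'.
  by rewrite (_ : (fun mu => _) = fun mu => geo q.+1 mu (f mu)) //; apply/funext => mu /=; rewrite scalerN.
elim: k => [|k IH]; first by rewrite mulr0n oppr0; exact: polyfun_cst.
have [b' pb'] := one m _ _ _ IH.
have := polyfun_stepD sV ls' Vs' IH pb'; rewrite mulrSr opprD.
by rewrite (_ : (fun mu => _) = fun mu => iter k.+1 (geo m.+1 mu) x) //; apply/funext => mu /=; rewrite scalerN.
Qed.

Let poly_A k f a b : polyfun Z f a b -> polyfun Z (fun mu => iter k (A mu) (f mu)) a (b + s a *+ k).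
Proof.
move=> pf; elim: k => [|k IH]; first by rewrite addr0.
by rewrite mulrSr addrA; exact: (polyfun_stepD sZ ls Zs IH IH).
Qed.

(** There are two subspaces because [T] maps [V] only into [Z]: the bounds hold on [V], while
    normality is available on all of [Z], where [T x] lives. *)
Lemma Fuglede x : V x -> s (T x) = T (s x).
Proof.
move=> Vx; apply/eqP; rewrite -subr_eq0; apply/eqP.
set z := _ - _.
have r1 : 0 < `|r| + 1 by rewrite ltr_wpDl.
(* On the circle of radius [rho] the operator mu s has norm at most 1/2 on [V]. *)
pose rho := (2 * (`|r| + 1))^-1; have rho0 : 0 < rho by rewrite invr_gt0 mulr_gt0.
have key k : k%:R * (rho * nrm z) <= 2 * `|c| * nrm x.
  have [m hm] := pow1D_le2 R k.
  have := poly_A k (polyfun_lin sV lT VT (poly_geo m k Vx)).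
  (* The linear coefficient: the [k] factors geo contribute - k T s x and the [k] factors 1 + mu s
     contribute k s T x. *)
  have -> : T (- (s x *+ k)) + s (T x) *+ k = k%:R *: z.
    rewrite (lin_onN lT) ?(lin_onMn _ sV lT) ?scaler_nat ?mulrnBl; auto.
      by rewrite addrC.
    by rewrite -scaler_nat; have [_ _] := sV; apply; auto.
  move=> pf; have := @cauchy_estimate _ _ _ _ rho (2 * `|c| * nrm x) pf (ltW rho0).
  rewrite nrmZ // normr_nat => h.
  rewrite mulrCA; apply: le_trans (h _); first by rewrite -(rmorph_nat (real_complex R)).
  move=> mu hmu.
  have VA' x' : V x' -> V (A' mu x') by apply: stab_stepA.
  have Vy : V (iter k (geo m.+1 mu) x) by apply: stab_iter => // w; exact: stab_geo.
  have half x' : V x' -> nrm (mu *: s x') <= 2^-1 * nrm x'.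
    move=> Vx'; rewrite nrmZ // hmu /= /rho invfM -mulrA ler_wpM2l ?invr_ge0 ?ler0n //.
    rewrite ler_pdivrMl //; apply: le_trans (sr Vx') _.
    by rewrite ler_wpM2r ?nrm_ge0 //; have := ler_norm r; lra.
  rewrite nrm_iterA; last exact: VT.
  have -> : iter k (A' mu) (T (iter k (geo m.+1 mu) x)) = T (iter k (A' mu) (iter k (geo m.+1 mu) x)).
    move: (iter k (geo _ _) x) Vy => y Vy; elim: (k) => //= j ->.
    have Vj : V (iter j (A' mu) y) by exact: stab_iter.
    have [_ _ VZ'] := sV.
    by rewrite /A' /stepA (proj1 lT) ?(proj2 lT) ?Tn //; auto.
  have Vk : V (iter k (A' mu) (iter k (geo m.+1 mu) x)) by exact: stab_iter.
  apply: le_trans (Tc Vk) _; rewrite -nrm_iterA; last exact: VZ.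
  have := nrm_iter_A_geo m.+1 k Vx half; set q := nrm (iter _ _ _) => hq.
  have q0 : 0 <= q by exact: nrm_ge0.
  apply: (@le_trans _ _ (`|c| * q)); first by rewrite ler_wpM2r ?ler_norm.
  rewrite (mulrC 2) -mulrA ler_wpM2l //; apply: le_trans hq _.
  by rewrite ler_wpM2r ?nrm_ge0.
apply: (nrm_eq0 hI); rewrite leNgt; apply/negP => z0.
have q0 : 0 < rho * nrm z by exact: mulr_gt0.
have := key (Num.bound (2 * `|c| * nrm x / (rho * nrm z))).
rewrite leNgt -ltr_pdivrMr // => /negP; apply; apply: archi_boundP.
by rewrite divr_ge0 ?(ltW q0) ?mulr_ge0 ?nrm_ge0.
Qed.

End Bounded.
End Fuglede.

(** * Graphs and adjoints of unbounded operators *)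

Section Operators.
Variables (R : realType) (H : lmodType R[i]) (ip : H -> H -> R[i]).
Hypothesis hH : is_hilbert ip.
Local Notation rip := (reip ip).
Local Notation nrm := (hnorm ip).
Local Notation tends := (hlim ip).
Let hI : is_inner_product ip. Proof. by case: hH. Qed.
Let hF : is_form ip. Proof. exact: ip_form. Qed.

Lemma closed_opP (P : op H) : closed_op ip P <->
  forall u x y, (forall n, dom P (u n)) -> tends u x -> tends (fun n => app P (u n)) y ->
    dom P x /\ app P x = y.
Proof.
split=> h u x y hu hx hy; apply: (h u) => //; exact/(cvg_tends hI).
Qed.

Lemma linear_op_sub (P : op H) x y : linear_op P -> dom P x -> dom P y ->
  dom P (x - y) /\ app P (x - y) = app P x - app P y.
Proof.
move=> [P0 PD PZ PaD PaZ] dx dy; have dNy : dom P (- y) by rewrite -scaleN1r; exact: PZ.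
by split; [exact: PD | rewrite PaD // -(scaleN1r y) PaZ // scaleN1r].
Qed.

Lemma linear_op0 (P : op H) : linear_op P -> app P 0 = 0.
Proof. by case=> P0 _ _ _ PaZ; have := PaZ 0 0 P0; rewrite !scale0r. Qed.

(** The inner product of the Hilbert sum of two copies of [H], in which graphs of operators are
    subspaces. *)
Definition pair_ip (a b : (H * H)%type) : R[i] := ip a.1 b.1 + ip a.2 b.2.

Lemma pair_rip a b : reip pair_ip a b = rip a.1 b.1 + rip a.2 b.2.
Proof. by rewrite /reip /pair_ip raddfD. Qed.

Lemma pair_inner : is_inner_product pair_ip.
Proof.
split=> [a x y z|x y|x|x].
- by rewrite /pair_ip /= !(form_linl hF); ring.
- by rewrite /pair_ip (form_conj hF x.1) (form_conj hF x.2) -rmorphD.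
- by rewrite addr_ge0 ?(form_ge0 hF).
- rewrite /pair_ip !formxx // -rmorphD => /complexI/eqP; rewrite paddr_eq0 ?rip_ge0 //.
  by case: x => a b /= /andP[/eqP/(rip_eq0 hI) -> /eqP/(rip_eq0 hI) ->].
Qed.

Lemma pair_nrm_le1 a : nrm a.1 <= hnorm pair_ip a.
Proof.
rewrite /hnorm ler_sqrt; last exact: rip_ge0 (ip_form pair_inner) _.
by rewrite pair_rip lerDl rip_ge0.
Qed.

Lemma pair_nrm_le2 a : nrm a.2 <= hnorm pair_ip a.
Proof.
rewrite /hnorm ler_sqrt; last exact: rip_ge0 (ip_form pair_inner) _.
by rewrite pair_rip lerDr rip_ge0.
Qed.

Lemma pair_tends u p : hlim pair_ip u p ->
  tends (fun n => (u n).1) p.1 /\ tends (fun n => (u n).2) p.2.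
Proof.
move=> h; split=> e /h[N hN]; exists N => n /hN; apply: le_lt_trans.
  exact: (pair_nrm_le1 (u n - p)).
exact: (pair_nrm_le2 (u n - p)).
Qed.

Lemma pair_hilbert : is_hilbert pair_ip.
Proof.
split; first exact: pair_inner.
have comp (f : H * H -> H) (u : nat -> (H * H)%type) : (forall a b, f (a - b) = f a - f b) ->
    (forall a, nrm (f a) <= hnorm pair_ip a) -> cauchy_seq pair_ip u ->
    exists x, tends (fun n => f (u n)) x.
  move=> fB fle hu; apply: (complete hH) => e e0.
  have [|N hN] := hu (e ^+ 2)%:C; first by rewrite (ltcR 0) exprn_gt0.
  exists N => n Nn; have := hN n N Nn (leqnn _).
  rewrite (formxx (ip_form pair_inner)) ltcR -(nrm_sqr pair_inner) ltr_sqr ?nnegrE ?nrm_ge0 ?(ltW e0) //.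
  by rewrite -fB; exact: le_lt_trans (fle _).
move=> u hu.
have [x hx] := comp fst u (fun _ _ => erefl) pair_nrm_le1 hu.
have [y hy] := comp snd u (fun _ _ => erefl) pair_nrm_le2 hu.
exists (x, y); apply/(cvg_tends pair_inner) => e e0.
have e2 : 0 < e / 2 by lra.
have [N hN] := hx _ e2; have [M hM] := hy _ e2.
exists (maxn N M) => n; rewrite geq_max => /andP[/hN h1 /hM h2].
apply: (@le_lt_trans _ _ (nrm ((u n).1 - x) + nrm ((u n).2 - y))); last lra.
apply: (nrm_le_sqr pair_inner); first by rewrite addr_ge0 ?nrm_ge0.
rewrite pair_rip -!(nrm_sqr hI) sqrrD -addrA lerD2l lerDr mulrn_wge0 // mulr_ge0 ?nrm_ge0 //.
Qed.

(** * Graph projections and comparison of domains *)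

Section Pair.
Variables P Q : op H.
Hypotheses (linP : linear_op P) (clP : closed_op ip P).

(** The adjoint relation is split into two halves. This one is symmetric in the two operators, so it
    passes to the pair ([Ns], [N]) without the theorem on double adjoints. *)
Definition formal_adjoint := forall x y, dom P x -> dom Q y -> rip (app P x) y = rip x (app Q y).

Definition adjoint_maximal := forall y z,
  (forall x, dom P x -> rip (app P x) y = rip x z) -> dom Q y /\ app Q y = z.

(* Project [(y, 0)] orthogonally onto the graph of [P]. *)
Lemma one_plus_PP_onto : adjoint_maximal ->
  forall y, exists x, [/\ dom P x, dom Q (app P x) & x + app Q (app P x) = y].
Proof.
move=> maxQ y; have [P0 PD PZ PaD PaZ] := linP.
pose V (a : (H * H)%type) := dom P a.1 /\ a.2 = app P a.1.
have sV : subspace V.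
  split; first by split=> //=; rewrite linear_op0.
    by move=> [a a'] [b b'] [/= da ->] [/= db ->]; split=> /=; [exact: PD | rewrite PaD].
  by move=> c [a a'] [/= da ->]; split=> /=; [exact: PZ | rewrite PaZ].
have [u [[p1 p2] [hu /pair_tends[/= t1 t2] orth]]] := projection pair_hilbert (y, 0) sV.
have t2' : tends (fun n => app P (u n).1) p2.
  by rewrite (_ : (fun n => _) = fun n => (u n).2) //; apply/funext => n; case: (hu n).
have [|dp ep] := (iffLR (closed_opP P)) clP (fun n => (u n).1) p1 p2 _ t1 t2'.
  by move=> n; case: (hu n).
have [w dw|dq eq] := maxQ p2 (y - p1).
  have := orth (w, app P w) (conj dw erefl); rewrite pair_rip /= ripBl // ripBl // rip0l //.
  by rewrite ripBr // !(ripC hF w) (ripC hF (app P w)); lra.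
by exists p1; rewrite ep eq; split=> //; rewrite addrC subrK.
Qed.

Hypothesis adjPQ : formal_adjoint.
Hypothesis onto : forall y, exists x, [/\ dom P x, dom Q (app P x) & x + app Q (app P x) = y].

(** The domain of QP is a core for P. Project (x, P x) onto the graph of P restricted to it: the
    residual [x - p1] is orthogonal to every w + Q P w, and by [onto] these fill [H]. *)
Lemma dom_QP_core x : linear_op Q -> dom P x -> exists u, [/\ forall n, dom P (u n) /\ dom Q (app P (u n)),
  tends u x & tends (fun n => app P (u n)) (app P x)].
Proof.
move=> linQ dx; have [P0 PD PZ PaD PaZ] := linP; have [Q0 QD QZ QaD QaZ] := linQ.
pose V (a : (H * H)%type) := [/\ dom P a.1, dom Q (app P a.1) & a.2 = app P a.1].
have sV : subspace V.
  split; first by split=> //=; rewrite linear_op0.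
    move=> [a a'] [b b'] [/= da qa ->] [/= db qb ->]; split=> /=; first exact: PD.
      by rewrite PaD //; exact: QD.
    by rewrite PaD.
  move=> c [a a'] [/= da qa ->]; split=> /=; first exact: PZ.
    by rewrite PaZ //; exact: QZ.
  by rewrite PaZ.
have [u [[p1 p2] [hu /pair_tends[/= t1 t2] orth]]] := projection pair_hilbert (x, app P x) sV.
have t2' : tends (fun n => app P (u n).1) p2.
  by rewrite (_ : (fun n => _) = fun n => (u n).2) //; apply/funext => n; case: (hu n).
have [|dp ep] := (iffLR (closed_opP P)) clP (fun n => (u n).1) p1 p2 _ t1 t2'.
  by move=> n; case: (hu n).
have [dd ed] := linear_op_sub linP dx dp.
have xp : x = p1.
  apply/eqP; rewrite -subr_eq0; apply/eqP; apply: (rip_eq0 hI).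
  have [w [dw qw ew]] := onto (x - p1).
  have := orth (w, app P w); rewrite pair_rip /= -{1}ep -ed adjPQ // -ripDr // ew; apply.
  by split.
exists (fun n => (u n).1); by rewrite xp ep; split=> // n; case: (hu n).
Qed.

(** Along the approximating sequence in the core, equality of norms makes the values of [Q] Cauchy,
    and [Q] is closed. *)
Lemma dom_subset : linear_op Q -> closed_op ip Q ->
  (forall x, dom P x -> dom Q (app P x) ->
     dom Q x /\ rip (app Q x) (app Q x) = rip (app P x) (app P x)) ->
  forall x, dom P x -> dom Q x.
Proof.
move=> linQ clQ hPQ x dx; have [u [hu ux pux]] := dom_QP_core linQ dx.
have [P0 PD PZ PaD PaZ] := linP; have [Q0 QD QZ QaD QaZ] := linQ.
have [y hy] : exists y, tends (fun n => app Q (u n)) y.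
  apply: (complete hH) => e e0; have e2 : 0 < e / 2 by lra.
  have [N hN] := pux _ e2; exists N => n Nn.
  have [[dn qn] [dN qN]] := (hu n, hu N).
  have [dd ed] := linear_op_sub linP dn dN.
  have [qd eqd] := linear_op_sub linQ qn qN.
  have [|qq ee] := hPQ _ dd; first by rewrite ed.
  have [_ <-] := linear_op_sub linQ (proj1 (hPQ _ dn qn)) (proj1 (hPQ _ dN qN)).
  rewrite /hnorm ee -/(nrm _) ed.
  have := nrm_dist hI (app P (u n)) (app P x) (app P (u N)); rewrite (nrmBC hI (app P x)).
  by have := hN _ Nn; have := hN _ (leqnn N); lra.
have [|//] := (iffLR (closed_opP Q)) clQ u x y _ ux hy.
by move=> n; have [dn qn] := hu n; have [] := hPQ _ dn qn.
Qed.

End Pair.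

(** * The adjoint of a densely defined operator *)

Section Adjoint.
Variables N Ns : op H.
Hypotheses (linN : linear_op N) (denseN : dense ip (dom N)) (adjN : is_adjoint ip N Ns).

Lemma dense_orth z : (forall x, dom N x -> rip x z = 0) -> z = 0.
Proof.
move=> hz; have [u [hu /(cvg_tends hI) uz]] := denseN z; apply: (rip_eq0 hI).
by apply: (orth_lim hI uz) => n; exact: hz.
Qed.

Lemma adj_formal : formal_adjoint N Ns.
Proof. by move=> x y dx dy; rewrite /reip (proj2 adjN). Qed.

(** Equality of real parts gives the complex identity after replacing [x] by its scalar multiples;
    density makes the value unique. *)
Lemma adj_maximal : adjoint_maximal N Ns.
Proof.
have [N0 ND NZ NaD NaZ] := linN => y z h.
have dy : dom Ns y.
  apply/(proj1 adjN); exists z => x dx; apply: form_rip_eq => // a.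
  have conj_move v w : rip v (a *: w) = rip (a^* *: v) w.
    by rewrite /reip formZr // formZl.
  by rewrite !conj_move -NaZ // h //; exact: NZ.
split=> //; apply/eqP; rewrite -subr_eq0; apply/eqP; apply: dense_orth => x dx.
by rewrite ripBr // -adj_formal // h // subrr.
Qed.

Lemma adj_linear : linear_op Ns.
Proof.
have D x y : dom Ns x -> dom Ns y -> dom Ns (x + y) /\ app Ns (x + y) = app Ns x + app Ns y.
  by move=> dx dy; apply: adj_maximal => w dw; rewrite !ripDr // !adj_formal.
have Z (a : R[i]) x : dom Ns x -> dom Ns (a *: x) /\ app Ns (a *: x) = a *: app Ns x.
  have [N0 ND NZ NaD NaZ] := linN => dx; apply: adj_maximal => w dw.
  have conj_move v w' : rip v (a *: w') = rip (a^* *: v) w'.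
    by rewrite /reip formZr // formZl.
  by rewrite !conj_move -NaZ // adj_formal //; exact: NZ.
split=> [|x y dx dy|a x dx|x y dx dy|a x dx].
- by have [] := adj_maximal (y := 0) (z := 0) _ => // w _; rewrite !(ripC hF _ 0) !rip0l.
- by have [] := D _ _ dx dy.
- by have [] := Z a _ dx.
- by have [] := D _ _ dx dy.
- by have [] := Z a _ dx.
Qed.

Lemma adj_closed : closed_op ip Ns.
Proof.
apply/closed_opP => u x y du ux uy; apply: adj_maximal => w dw.
by rewrite ripC //; apply: (rip_lim hI ux uy) => n; rewrite ripC // adj_formal.
Qed.

End Adjoint.
End Operators.

(** * Normal operators and their commutants *)

Section Normal.
Variables (R : realType) (H : lmodType R[i]) (ip : H -> H -> R[i]).
Hypothesis hH : is_hilbert ip.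
Local Notation rip := (reip ip).
Local Notation nrm := (hnorm ip).
Local Notation tends := (hlim ip).
Let hI : is_inner_product ip. Proof. by case: hH. Qed.
Let hF : is_form ip. Proof. exact: ip_form. Qed.

Variables N Ns : op H.
Hypothesis hN : normal_op ip N Ns.

Let linN : linear_op N. Proof. by case: hN. Qed.
Let denseN : dense ip (dom N). Proof. by case: hN. Qed.
Let clN : closed_op ip N. Proof. by case: hN. Qed.
Let adjN : is_adjoint ip N Ns. Proof. by case: hN. Qed.
Let linNs : linear_op Ns. Proof. exact (adj_linear hH linN denseN adjN). Qed.
Let clNs : closed_op ip Ns. Proof. exact (adj_closed hH linN denseN adjN). Qed.

Lemma normal_swap x : (dom N x /\ dom Ns (app N x)) <-> (dom Ns x /\ dom N (app Ns x)).
Proof. by case: hN => _ _ _ _ [/(_ x)[h1 h2] _]; split=> [/h2|/h1]. Qed.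

Lemma normal_comm x : dom N x -> dom Ns (app N x) -> app N (app Ns x) = app Ns (app N x).
Proof. by move=> d1 d2; case: hN => _ _ _ _ [_ h]; apply: (h x); exact/normal_swap. Qed.

Lemma normal_onto y : exists x, [/\ dom N x, dom Ns (app N x) & x + app Ns (app N x) = y].
Proof. by apply: (one_plus_PP_onto hH linN clN); exact (adj_maximal hH linN denseN adjN). Qed.

Lemma normal_onto' y : exists x, [/\ dom Ns x, dom N (app Ns x) & x + app N (app Ns x) = y].
Proof.
have [x [d1 d2 e]] := normal_onto y; exists x.
by have [d3 d4] := iffLR (normal_swap x) (conj d1 d2); rewrite normal_comm.
Qed.

Lemma normal_rip x : dom N x -> dom Ns (app N x) ->
  rip (app Ns x) (app Ns x) = rip (app N x) (app N x).
Proof.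
move=> d1 d2; have [d3 d4] := iffLR (normal_swap x) (conj d1 d2).
rewrite -(adj_formal adjN d4 d3) (adj_formal adjN d1 d2) normal_comm //.
by rewrite ripC.
Qed.

(** [dom_subset] in both directions: on the domain of N* N, which is that of N N*, both operators
    give vectors of equal norm. *)
Lemma dom_normal x : dom N x <-> dom Ns x.
Proof.
split.
  apply: (dom_subset hH linN clN (adj_formal adjN) normal_onto linNs clNs) => z d1 d2.
  by split; [case: (iffLR (normal_swap z) (conj d1 d2)) | exact: normal_rip].
have adj' : formal_adjoint ip Ns N.
  by move=> z w dz dw; rewrite ripC // -(adj_formal adjN dw dz) ripC.
apply: (dom_subset hH linNs clNs adj' normal_onto' linN clN) => z d1 d2.
have [d3 d4] := iffRL (normal_swap z) (conj d1 d2).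
by split=> //; rewrite normal_rip.
Qed.

Lemma resolvent_uniq x : dom N x -> dom Ns (app N x) -> x + app Ns (app N x) = 0 -> x = 0.
Proof.
move=> d1 d2 e; apply: (rip_eq0 hI).
have := rip_ge0 hF x; have := rip_ge0 hF (app N x); rewrite (adj_formal adjN d1 d2).
by move/eqP: e; rewrite addrC addr_eq0 => /eqP ->; rewrite ripNr //; lra.
Qed.

(* The hypothesis on [B] says that [B = (1 + N* N)^-1]. *)
Section Resolvent.
Variable B : H -> H.
Hypothesis hB : forall y, [/\ dom N (B y), dom Ns (app N (B y)) & B y + app Ns (app N (B y)) = y].

Lemma domB y : dom N (B y). Proof. by case: (hB y). Qed.
Lemma domNsNB y : dom Ns (app N (B y)). Proof. by case: (hB y). Qed.
Lemma domNsB y : dom Ns (B y). Proof. by case: (iffLR (normal_swap _) (conj (domB y) (domNsNB y))). Qed.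
Lemma domNNsB y : dom N (app Ns (B y)).
Proof. by case: (iffLR (normal_swap _) (conj (domB y) (domNsNB y))). Qed.
Lemma resolventE y : B y + app Ns (app N (B y)) = y. Proof. by case: (hB y). Qed.
Lemma resolventE' y : B y + app N (app Ns (B y)) = y.
Proof. by rewrite normal_comm ?resolventE //; [exact: domB | exact: domNsNB]. Qed.

Lemma resolventP x y : dom N x -> dom Ns (app N x) -> x + app Ns (app N x) = y -> B y = x.
Proof.
move=> d1 d2 e; apply/eqP; rewrite -subr_eq0; apply/eqP.
have [d3 e3] := linear_op_sub linN (domB y) d1.
have [d4 e4] := linear_op_sub linNs (domNsNB y) d2.
apply: resolvent_uniq; rewrite ?e3 // e4 addrACA -opprD resolventE e subrr //.
Qed.

Lemma resolvent_lin : islin B.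
Proof.
have [N0 ND NZ NaD NaZ] := linN; have [M0 MD MZ MaD MaZ] := linNs.
split=> [x y|a x]; apply: resolventP.
- by apply: ND; exact: domB.
- by rewrite NaD; [apply: MD; exact: domNsNB | exact: domB | exact: domB].
- rewrite NaD; [|exact: domB|exact: domB]; rewrite MaD; [|exact: domNsNB|exact: domNsNB].
  by rewrite addrACA !resolventE.
- by apply: NZ; exact: domB.
- by rewrite NaZ; [apply: MZ; exact: domNsNB | exact: domB].
- rewrite NaZ; [|exact: domB]; rewrite MaZ; [|exact: domNsNB].
  by rewrite -scalerDr resolventE.
Qed.

(** Obtained by expanding [y] through the resolvent equation; the right side is symmetric and
    positive, whence self-adjointness and the contraction estimates. *)
Lemma rip_resolvent x y : rip (B x) y = rip (B x) (B y) + rip (app N (B x)) (app N (B y)).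
Proof. by rewrite -{1}(resolventE y) ripDr // (adj_formal adjN (domB x) (domNsNB y)). Qed.

Lemma resolvent_selfadj : selfadj ip B.
Proof. by move=> x y; rewrite rip_resolvent ripC // (ripC hF (app N _)) -rip_resolvent ripC. Qed.

Lemma resolvent_contr x : rip (B x) (B x) <= rip (B x) x.
Proof. by rewrite (rip_resolvent x x) lerDl rip_ge0. Qed.

Lemma resolvent_inj x : B x = 0 -> x = 0.
Proof. by move=> e; rewrite -(resolventE x) e !linear_op0 // addr0. Qed.

Lemma resolvent_bound : bounded_by ip 1 B.
Proof.
move=> x; rewrite mul1r; have := resolvent_contr x; have := rip_le hI (B x) x.
rewrite -(nrm_sqr hI (B x)); have := nrm_ge0 ip x.
by have := nrm_ge0 ip (B x); nra.
Qed.

Lemma NB_bound x : nrm (app N (B x)) <= nrm x.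
Proof.
apply: nrm_le_sqr (nrm_ge0 _ _) _ => //; have := rip_resolvent x x.
have := rip_le hI (B x) x; have := rip_ge0 hF (B x); have := nrm_ge0 ip x.
by have := resolvent_bound x; rewrite mul1r; nra.
Qed.

Lemma NsB_bound : bounded_by ip 1 (fun x => app Ns (B x)).
Proof.
move=> x; rewrite mul1r /hnorm normal_rip; [exact: NB_bound | exact: domB | exact: domNsNB].
Qed.

Lemma NsB_lin : islin (fun x => app Ns (B x)).
Proof.
have [M0 MD MZ MaD MaZ] := linNs; have [BD BZ] := resolvent_lin.
split=> [x y|a x]; first by rewrite BD MaD //; exact: domNsB.
by rewrite BZ MaZ //; exact: domNsB.
Qed.

(** By uniqueness in the resolvent equation: [N (B w)] solves it for [N w], since N* N B w = w - B w
    lies in the domain of N. *)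
Lemma resolvent_comm : commutes_with B N.
Proof.
have [N0 ND NZ NaD NaZ] := linN.
move=> w dw; split; first exact: domB.
have dNB : dom N (app Ns (app N (B w))).
  rewrite -[app Ns _](addKr (B w)) resolventE addrC.
  by have [] := linear_op_sub linN dw (domB w).
have dd : dom N (app N (B w)) /\ dom Ns (app N (app N (B w))).
  by apply/normal_swap; split=> //; exact: domNsNB.
symmetry; apply: resolventP; [by case: dd | by case: dd |].
by rewrite -(normal_comm (proj1 dd) (proj2 dd)) -NaD ?resolventE //; exact: domB.
Qed.

Lemma resolvent_comm_adj : commutes_with B Ns.
Proof.
have [M0 MD MZ MaD MaZ] := linNs.
move=> w dw; split; first exact: domNsB.
have dNB : dom Ns (app N (app Ns (B w))).
  rewrite -[app N _](addKr (B w)) resolventE' addrC.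
  by have [] := linear_op_sub linNs dw (domNsB w).
have d2 := domNNsB w.
symmetry; apply: resolventP => //.
rewrite -MaD ?resolventE' //; exact: domNsB.
Qed.

(** The domain of the k-th power of N. The intersection [Z] is invariant under N and N* and serves
    as the larger space in [Fuglede], as T sends spectral subspaces into it. *)
Fixpoint smooth k x := if k is k'.+1 then dom N x /\ smooth k' (app N x) else True.
Let Z x := forall k, smooth k x.

Lemma smooth_dom x : Z x -> [/\ dom N x, Z (app N x), dom Ns x & dom Ns (app N x)].
Proof.
move=> Zx; have [d1 [d2 _]] := Zx 2%N.
have ZN : Z (app N x) by move=> k; case: (Zx k.+1).
by split=> //; apply/dom_normal.
Qed.

Lemma smooth_subspace : subspace Z.
Proof.
have [N0 ND NZ NaD NaZ] := linN; split=> [|x y + + k|a x + k].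
- by elim=> //= k; rewrite linear_op0.
- elim: k x y => //= k IH x y Zx Zy; have [dx ZNx _ _] := smooth_dom Zx.
  have [dy ZNy _ _] := smooth_dom Zy; split; first exact: ND.
  by rewrite NaD //; exact: IH.
- elim: k x => //= k IH x Zx; have [dx ZNx _ _] := smooth_dom Zx.
  by split; [exact: NZ | rewrite NaZ //; exact: IH].
Qed.

Lemma smooth_adj x : Z x -> Z (app Ns x).
Proof.
move=> + k; elim: k x => //= k IH x Zx; have [d1 ZN d2 d3] := smooth_dom Zx.
have [_ d4] := iffLR (normal_swap x) (conj d1 d3).
by split=> //; rewrite normal_comm //; exact: IH.
Qed.

(** * Closed operators commuting with a normal operator *)

Section Commutant.
Variable T : op H.
Hypotheses (linT : linear_op T) (clT : closed_op ip T).
Hypothesis domT : forall x, dom N x -> dom T x.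
Hypothesis commT : op_sub (op_comp T N) (op_comp N T).

Lemma comm_dom x : dom N x -> dom T (app N x) ->
  dom N (app T x) /\ app N (app T x) = app T (app N x).
Proof.
move=> d1 d2; have [h1 h2] := commT.
by have [_ d3] := h1 x (conj d1 d2); split=> //; exact: (h2 x (conj d1 d2)).
Qed.

Lemma comp_islin S : islin S -> (forall x, dom T (S x)) -> islin (fun x => app T (S x)).
Proof.
have [_ _ _ TD TZ] := linT => -[SD SZ] dS.
by split=> [x y|a x]; rewrite ?SD ?SZ ?TD ?TZ.
Qed.

(** T S is everywhere defined, and its graph is closed because S is bounded and T closed. *)
Lemma comp_bounded S c : islin S -> bounded_by ip c S -> (forall x, dom T (S x)) ->
  exists c', bounded_by ip c' (fun x => app T (S x)).
Proof.
move=> linS bS dS; apply: (closed_graph hH); first exact: comp_islin.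
move=> u x y ux Ty.
by have [] := (iffLR (closed_opP hH T)) clT _ _ y (fun n => dS (u n)) (lin_tends linS bS ux) Ty.
Qed.

Let dTB x : dom T (B x). Proof. by apply: domT; exact: domB. Qed.
Let dTNsB x : dom T (app Ns (B x)). Proof. by apply: domT; exact: domNNsB. Qed.

(** Writing w = B w' with |w'| <= |w| / e bounds T and N* on W through T B and N* B. The relation
    with [B] then holds because T B w solves the resolvent equation for T w. *)
Lemma Fuglede_spectral W e : 0 < e -> subspace W -> (forall w, W w -> W (B w)) ->
  (forall w, W w -> exists w', [/\ W w', B w' = w & nrm w' <= e^-1 * nrm w]) ->
  (forall w, W w -> W (app N w)) -> (forall w, W w -> W (app Ns w)) ->
  forall w, W w -> [/\ dom N (app T w), dom Ns (app T w), app Ns (app T w) = app T (app Ns w)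
    & B (app T w) = app T (B w)].
Proof.
move=> e0 sW WB Winv WN WNs.
have [N0 ND NZ NaD NaZ] := linN; have [M0 MD MZ MaD MaZ] := linNs.
have [T0 TD TZ TaD TaZ] := linT.
have dNW w : W w -> dom N w by move=> /Winv[w' [_ <- _]]; exact: domB.
have dTW w : W w -> dom T w by move=> /dNW; exact: domT.
have WZ w : W w -> Z w.
  by move=> + k; elim: k w => //= k IH w Ww; split; [exact: dNW | apply: IH; exact: WN].
have TN w : W w -> dom N (app T w) /\ app N (app T w) = app T (app N w).
  by move=> Ww; apply: comm_dom; [exact: dNW | apply: dTW; exact: WN].
have TZ' w : W w -> Z (app T w).
  by move=> + k; elim: k w => //= k IH w Ww; have [d ->] := TN w Ww; split=> //; apply: IH; exact: WN.
have [c hc] := comp_bounded resolvent_lin resolvent_bound dTB.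
have Fug w : W w -> app Ns (app T w) = app T (app Ns w).
  apply: (Fuglede hI (n := app N) (Z := Z) (c := `|c| * e^-1) (r := e^-1) sW smooth_subspace) => //.
  - by split=> [x y /smooth_dom[dx _ _ _] /smooth_dom[dy _ _ _]|a x /smooth_dom[dx _ _ _]]; [exact: NaD|exact: NaZ].
  - by split=> [x y /smooth_dom[_ _ dx _] /smooth_dom[_ _ dy _]|a x /smooth_dom[_ _ dx _]]; [exact: MaD|exact: MaZ].
  - by split=> [x y /dTW dx /dTW dy|a x /dTW dx]; [exact: TaD|exact: TaZ].
  - by move=> x /smooth_dom[].
  - exact: smooth_adj.
  - by move=> x /smooth_dom[d1 _ _ d2]; exact: normal_comm.
  - by move=> x y /smooth_dom[dx _ _ _] /smooth_dom[_ _ dy _]; case: adjN => _; apply.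
  - by move=> x Wx; case: (TN x Wx).
  - move=> x /Winv[x' [_ <- hx]]; apply: le_trans (hc x') _.
    apply: (@le_trans _ _ (`|c| * nrm x')); first by rewrite ler_wpM2r ?nrm_ge0 ?ler_norm.
    by rewrite -mulrA ler_wpM2l.
  - by move=> x /Winv[x' [_ <- hx]]; apply: le_trans (NsB_bound x') _; rewrite mul1r.
move=> w Ww; have [dNT _ dNsT _] := smooth_dom (TZ' w Ww).
split=> //; first exact: Fug.
have WBw := WB w Ww; have [d1 _ _ d2] := smooth_dom (TZ' _ WBw).
apply: resolventP => //; have [_ ->] := TN _ WBw.
rewrite Fug; last exact: WN.
have dT2 : dom T (app Ns (app N (B w))) by apply: dTW; apply: WNs; apply: WN.
by rewrite -TaD ?resolventE //; exact: dTW.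
Qed.

(** The vectors satisfying the relations form a closed subspace, as T B and T N* B are bounded and
    N* is closed. It contains every spectral subspace, so a vector [z] orthogonal to it has (B z, z)
    <= e |z|^2 for all small e, and z = 0. *)
Lemma resolvent_relations v :
  [/\ dom Ns (app T (B v)), app Ns (app T (B v)) = app T (app Ns (B v)),
      B (app T (B v)) = app T (B (B v)) & B (app T (app Ns (B v))) = app T (B (app Ns (B v)))].
Proof.
have [M0 MD MZ MaD MaZ] := linNs.
have linB := resolvent_lin; have bB := resolvent_bound.
pose V v := [/\ dom Ns (app T (B v)), app Ns (app T (B v)) = app T (app Ns (B v)),
  B (app T (B v)) = app T (B (B v)) & B (app T (app Ns (B v))) = app T (B (app Ns (B v)))].
have l1 : islin (fun v => app T (B v)) by exact: comp_islin.
have l2 : islin (fun v => app T (app Ns (B v))) by apply: comp_islin => //; exact: NsB_lin.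
have [c1 b1] := comp_bounded linB bB dTB.
have [c2 b2] := comp_bounded NsB_lin NsB_bound dTNsB.
have [[D1 Z1] [D2 Z2] [DB ZB] [DM ZM]] := And4 l1 l2 linB NsB_lin.
have sV : subspace V.
  split=> [|x y [d1 e1 e2 e3] [d1' e1' e2' e3']|a x [d1 e1 e2 e3]].
  - have B0 := islin0 linB; have T0 := linear_op0 linT; have Ns0 := linear_op0 linNs.
    by rewrite /V !(B0, T0, Ns0).
  - split; rewrite ?D1 ?D2; first exact: MD.
    + by rewrite MaD // e1 e1'.
    + by rewrite [LHS]DB e2 e2' -D1 -DB.
    + by rewrite [LHS]DB e3 e3' -D1 -DM.
  - split; rewrite ?Z1 ?Z2; first exact: MZ.
    + by rewrite MaZ // e1.
    + by rewrite [LHS]ZB e2 -Z1 -ZB.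
    + by rewrite [LHS]ZB e3 -Z1 -ZM.
have clV u x : (forall n, V (u n)) -> tends u x -> V x.
  move=> Vu ux; have t1 := lin_tends l1 b1 ux; have t2 := lin_tends l2 b2 ux.
  have tB := lin_tends linB bB ux; have tM := lin_tends NsB_lin NsB_bound ux.
  have t1' : tends (fun n => app Ns (app T (B (u n)))) (app T (app Ns (B x))).
    by rewrite (_ : (fun n => _) = fun n => app T (app Ns (B (u n)))) //; apply/funext => n; case: (Vu n).
  have dV n : dom Ns (app T (B (u n))) by case: (Vu n).
  have [d1 e1] := (iffLR (closed_opP hH Ns)) clNs _ _ _ dV t1 t1'.
  split=> //.
    apply: (tends_unique hI (lin_tends linB bB t1)).
    rewrite (_ : (fun n => _) = fun n => app T (B (B (u n)))); first exact: (lin_tends l1 b1 tB).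
    by apply/funext => n; case: (Vu n).
  apply: (tends_unique hI (lin_tends linB bB t2)).
  rewrite (_ : (fun n => _) = fun n => app T (B (app Ns (B (u n))))); first exact: (lin_tends l1 b1 tM).
  by apply/funext => n; case: (Vu n).
have [u [p [Vu up orth]]] := projection hH v sV.
suff -> : v = p by exact: clV up.
apply/eqP; rewrite -subr_eq0; apply/eqP; set z := v - p in orth *.
have small e : 0 < e <= 2^-1 -> rip (B z) z <= e * rip z z.
  move=> he; have [W [sW WB Winv Wcomm Worth]] :=
    spectral_split hH linB resolvent_selfadj resolvent_contr he.
  apply: Worth => w Ww; apply: orth.
  have dNW x : W x -> dom N x by move=> /Winv[w' [_ <- _]]; exact: domB.
  have WN x : W x -> W (app N x) by move=> Wx; apply: Wcomm => //; [exact: resolvent_comm | exact: dNW].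
  have WNs x : W x -> W (app Ns x).
    by move=> Wx; apply: Wcomm => //; [exact: resolvent_comm_adj | apply/dom_normal; exact: dNW].
  have e0 : 0 < e by case/andP: he.
  have Fug := Fuglede_spectral e0 sW WB Winv WN WNs.
  by have [_ d1 e1 e2] := Fug _ (WB _ Ww); have [_ _ _ e3] := Fug _ (WNs _ (WB _ Ww)); split.
have q0 : rip (B z) z <= 0.
  (* The value e = 1/2 shows |z| > 0 and makes e = (B z, z) / (2 |z|^2) admissible; the latter gives
     (B z, z) <= (B z, z) / 2. *)
  rewrite leNgt; apply/negP => q0; have := small 2^-1; rewrite lexx invr_gt0 ltr0n => /(_ isT) h.
  have t0 : 0 < rip z z by lra.
  have := small (rip (B z) z / (2 * rip z z)).
  have -> : rip (B z) z / (2 * rip z z) * rip z z = rip (B z) z / 2 by field; rewrite gt_eqF.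
  rewrite divr_gt0 ?mulr_gt0 //= ler_pdivrMr ?mulr_gt0 //.
  by move=> hh; have := hh _; lra.
by apply: resolvent_inj; apply: (rip_eq0 hI); apply: le_anti; rewrite rip_ge0 // andbT (le_trans (resolvent_contr z)).
Qed.

(** With y = B y + N z, one has B T y = B T B y + B N T z, and [B] moves past T on [B y] and on [z]
    by [resolvent_relations], and past N by [resolvent_comm]. *)
Lemma resolvent_comm_T y : dom T y -> B (app T y) = app T (B y).
Proof.
move=> dy; have [BD BZ] := resolvent_lin; have [T0 TD TZ TaD TaZ] := linT.
pose z := app Ns (B y); have dz : dom N z by exact: domNNsB.
have ez : app N z = y - B y by rewrite -{1}(resolventE' y) addrC addKr.
have [dTN eTN] := linear_op_sub linT dy (dTB y).
have [d1 e1] := comm_dom dz (eq_ind_r (dom T) dTN ez).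
have [_ _ r1 r2] := resolvent_relations y.
have Ty : app T y = app T (B y) + app N (app T z) by rewrite e1 ez eTN addrC subrK.
have [_ cN] := resolvent_comm d1; have [dBz cz] := resolvent_comm dz.
have [_ e2] := comm_dom dBz (eq_ind_r (dom T) (dTB _) cz).
rewrite Ty BD r1 -cN r2 e2 cz -TaD // -BD.
by rewrite ez addrC subrK.
Qed.

End Commutant.
End Resolvent.
End Normal.

(** * Removal of the resolvent *)

Theorem theorem3p1 (R : realType) (H : lmodType R[i]) (ip : H -> H -> R[i])
  (hH : is_hilbert ip) (T N Nstar : op H)
  (hTlin : linear_op T) (hTcl : closed_op ip T)
  (hN : normal_op ip N Nstar)
  (hdom : forall x, dom N x -> dom T x)
  (hcomm : op_sub (op_comp T N) (op_comp N T)) :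
  op_sub (op_comp T Nstar) (op_comp Nstar T).
Proof.
have [linN denseN clN adjN _] := hN.
have [_ SD _ SaD _] := adj_linear hH linN denseN adjN.
have [B hB] := choice (normal_onto hH hN).
suff main x : dom Nstar x -> dom T (app Nstar x) ->
    [/\ dom T x, dom Nstar (app T x) & app Nstar (app T x) = app T (app Nstar x)].
  split=> x [dx dTx]; first by have [d1 d2 _] := main x dx dTx.
  by have [] := main x dx dTx.
move=> dx dTx; have dTx' : dom T x by apply: hdom; apply/(dom_normal hH hN).
have BT := resolvent_comm_T hH hN hB hTlin hTcl hdom hcomm.
have [d1 e1 _ _] := resolvent_relations hH hN hB hTlin hTcl hdom hcomm x.
have [_ cB] := resolvent_comm_adj hH hN hB dx.
set u := app T x; set f := app T (app Nstar x).
(* The chain is N* B T x = N* T B x = T N* B x = T B N* x = B T N* x. *)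
have [dBu eBu] : dom Nstar (B u) /\ app Nstar (B u) = B f by rewrite !BT // -cB.
(* The resolvent equation u = B u + N N* B u exhibits [u] as a sum of two vectors in the domain of
   N*; applying N* gives B f + N* N B f = f. *)
have eu : u = B u + app N (B f) by rewrite -eBu (resolventE' hN hB).
have dNBf : dom Nstar (app N (B f)) by exact: domNsNB hB f.
split=> //; first by rewrite -/u eu; apply: SD.
by rewrite -/u eu SaD // eBu (resolventE hB).
Qed.
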